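(* Let $u_0\in\mathcal S_2(\mathbb R^n)$ be nonlinear at infinity, and let $\dot u_0\in C^2(\mathbb R^n)$ satisfy $\dot u_0(0)=0$. The Cauchy problem $$\ddot{(1/u)}+|\nabla(\dot u/u)|^2_{(\nabla^2u)^{-1}}=0,\qquad u(0,\cdot)=u_0,\quad\dot u(0,\cdot)=\dot u_0,$$ (for $x\neq 0$) admits a unique nonlinear-at-infinity solution $u(t)\in\mathcal S_2(\mathbb R^n)$, given by $$u(t,x)=\big(u_0^\circ\cdot(1-tv)\big)^\circ(x),\qquad t\in[0,T),$$ where $v(0)=0$ and $$v(y)=\frac{\dot u_0(\nabla^\circ u_0^\circ(y))}{u_0(\nabla^\circ u_0^\circ(y))},\qquad y\ne0,$$ and where $T=T(u_0,\dot u_0)$ is the supremum over all $t>0$ such that the function $u_0^\circ\cdot(1-tv)$ belongs to $\mathcal S_2(\mathbb R^n)$ and is nonlinear at infinity.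
   Context: The symbol $\dot u_0$ denotes a given function (the initial velocity). Otherwise dots denote $\partial/\partial t$; $\ddot{(1/u)}=\partial^2(1/u)/\partial t^2$; $\nabla,\nabla^2$ are in the variable $x$; $|X|^2_{(\nabla^2u)^{-1}}=\langle X,(\nabla^2u)^{-1}X\rangle$. $\mathrm{Cvx}_0(\mathbb R^n)$ is the set of convex lower semi-continuous $f:\mathbb R^n\to[0,+\infty]$ with $f(0)=0$; $\mathrm{dom}(f)=\{f<\infty\}$. The polar of $f$ is $f^\circ(y)=\inf\{c\ge0:\langle x,y\rangle\le1+cf(x)\ \forall x\in\mathbb R^n\}$. The polar subdifferential at $x\in\mathrm{dom}(f)$ is $\partial^\circ f(x)=\{y\in\mathrm{dom}(f^\circ):f^\circ(y)f(x)=\langle x,y\rangle-1\}$; if it is a single point $\{y\}$, one writes $\nabla^\circ f(x)=y$. ($\nabla^\circ u_0^\circ(y)$ exists for all $y\ne0$ under the hypotheses.) $\mathcal S_1(\mathbb R^n)$ is the class of $f\in\mathrm{Cvx}_0(\mathbb R^n)$ that are finite everywhere, continuously differentiable on $\mathbb R^n\setminus\{0\}$ and strictly convex (the graph contains no segment). $\mathcal S_2(\mathbb R^n)\subset\mathcal S_1(\mathbb R^n)$ is the subclass of functions twice continuously differentiable on $\mathbb R^n\setminus\{0\}$ with $\nabla^2f(x)>0$ for all $x\ne0$. A function $f\in\mathrm{Cvx}_0(\mathbb R^n)$ is nonlinear at infinity if for every ray $\mathbb R^+x$ ($x\ne0$) the function $t\mapsto f(tx)$, $t\in\mathbb R^+$,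 is finite on all of $\mathbb R^+$ and is not between $h(t)=at$ and $h(t)-b$ for any $a\ge0$, $b>0$ (i.e. there are no such $a,b$ with $at-b\le f(tx)\le at$ for all $t\ge0$). A nonlinear-at-infinity solution $u(t)\in\mathcal S_2$ is a function $u\in C^2([0,T)\times(\mathbb R^n\setminus\{0\}))$ with $u(t)=u(t,\cdot)\in\mathcal S_2(\mathbb R^n)$ nonlinear at infinity for each $t\in[0,T)$, satisfying the equation for $x\ne0$ and the initial conditions. If no $t>0$ is admissible in the definition of $T$, then $T=0$ and the claim is empty. *)

(* Defs.v *)
From HB Require Import structures.
From mathcomp Require Import all_boot all_order all_algebra.
From mathcomp Require Import all_classical all_reals all_analysis.

Set Implicit Arguments.
Unset Strict Implicit.
Unset Printing Implicit Defensive.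
Import Order.TTheory GRing.Theory Num.Theory.
Import numFieldNormedType.Exports.

Local Open Scope classical_set_scope.
Local Open Scope ring_scope.

Definition dot (R : realType) (n : nat) (x y : 'rV[R]_n) : R :=
  \sum_(i < n) x 0 i * y 0 i.

Definition std_basis (R : realType) (n : nat) (i : 'I_n) : 'rV[R]_n :=
  delta_mx 0 i.

Definition grad (R : realType) (n : nat) (f : 'rV[R]_n -> R) (x : 'rV[R]_n)
    : 'rV[R]_n :=
  \row_i 'D_(std_basis R i) f x.

Definition hessian (R : realType) (n : nat) (f : 'rV[R]_n -> R)
    (x : 'rV[R]_n) : 'M[R]_n :=
  \matrix_(i, j) 'D_(std_basis R j) ('D_(std_basis R i) f) x.

(* [<X, M X>]; with row vectors, the matrix [M] acts on [X] through
   [X *m M^T]. *)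
Definition quad_form (R : realType) (n : nat) (M : 'M[R]_n) (X : 'rV[R]_n)
    : R :=
  dot X (X *m M^T).

Definition pos_def (R : realType) (n : nat) (M : 'M[R]_n) : Prop :=
  forall z : 'rV[R]_n, z != 0 -> 0 < quad_form M z.

(* Only used for open sets [A], where the two-sided directional derivatives
   are the right ones. *)
Definition C1_on (R : realType) (n : nat) (A : set 'rV[R]_n)
    (f : 'rV[R]_n -> R) : Prop :=
  forall i : 'I_n,
    (forall x, A x -> derivable f x (std_basis R i)) /\
    {within A, continuous ('D_(std_basis R i) f)}.

Definition C2_on (R : realType) (n : nat) (A : set 'rV[R]_n)
    (f : 'rV[R]_n -> R) : Prop :=
  C1_on A f /\ forall i : 'I_n, C1_on A ('D_(std_basis R i) f).

Definition punctured (R : realType) (n : nat) : set 'rV[R]_n :=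
  [set x | x != 0].

Definition effective_dom (R : realType) (n : nat) (f : 'rV[R]_n -> \bar R)
    : set 'rV[R]_n :=
  [set x | (f x < +oo)%E].

Definition Cvx0 (R : realType) (n : nat) (f : 'rV[R]_n -> \bar R) : Prop :=
  [/\ forall x, (0 <= f x)%E,
      f 0 = 0%E,
      lower_semicontinuous f
    & forall (x y : 'rV[R]_n) (s : R), 0 <= s -> s <= 1 ->
        (f (s *: x + (1 - s) *: y)%R <= s%:E * f x + (1 - s)%:E * f y)%E].

(* The library convention [0 * +oo = 0] is harmless: if [c = 0] is thereby
   excluded because of points where [f] is infinite, all [c > 0] may still be
   admissible, and the infimum is the same. *)
Definition polar (R : realType) (n : nat) (f : 'rV[R]_n -> \bar R)
    (y : 'rV[R]_n) : \bar R :=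
  ereal_inf [set c%:E | c in
    [set c : R | 0 <= c /\
       forall x : 'rV[R]_n, ((dot x y)%:E <= 1 + c%:E * f x)%E]].

Definition polar_subdiff (R : realType) (n : nat) (f : 'rV[R]_n -> \bar R)
    (x : 'rV[R]_n) : set 'rV[R]_n :=
  [set y | [/\ effective_dom f x, effective_dom (polar f) y
             & (polar f y * f x = (dot x y - 1)%:E)%E]].

(* The unique polar subgradient; the default value is [0] when the polar
   subdifferential is not a single point. *)
Definition polar_grad (R : realType) (n : nat) (f : 'rV[R]_n -> \bar R)
    (x : 'rV[R]_n) : 'rV[R]_n :=
  xget 0 [set y | polar_subdiff f x = [set y]].

Definition graph_contains_segment (R : realType) (n : nat)
    (f : 'rV[R]_n -> \bar R) : Prop :=
  exists x y : 'rV[R]_n, x != y /\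
    forall s : R, 0 <= s -> s <= 1 ->
      (f (s *: x + (1 - s) *: y)%R = s%:E * f x + (1 - s)%:E * f y)%E.

Definition S1 (R : realType) (n : nat) (f : 'rV[R]_n -> \bar R) : Prop :=
  [/\ Cvx0 f,
      forall x, effective_dom f x,
      C1_on (@punctured R n) (fine \o f)
    & ~ graph_contains_segment f].

Definition S2 (R : realType) (n : nat) (f : 'rV[R]_n -> \bar R) : Prop :=
  [/\ S1 f,
      C2_on (@punctured R n) (fine \o f)
    & forall x : 'rV[R]_n, x != 0 -> pos_def (hessian (fine \o f) x)].

Definition nonlinear_at_infinity (R : realType) (n : nat)
    (f : 'rV[R]_n -> \bar R) : Prop :=
  forall x : 'rV[R]_n, x != 0 ->
    (forall t : R, 0 <= t -> (f (t *: x) < +oo)%E) /\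
    ~ (exists a b : R, [/\ 0 <= a, 0 < b
         & forall t : R, 0 <= t ->
             ((a * t - b)%:E <= f (t *: x))%E /\
             (f (t *: x) <= (a * t)%:E)%E]).

(* Increments [h] keeping the time [t + h] nonnegative: the resulting time
   derivative is the usual two-sided one for [t > 0] and the right derivative
   at [t = 0]. *)
Definition time_incr (R : realType) (t : R) : set_system R :=
  within [set h : R | 0 <= t + h] (0 : R)^'.

Definition dt_quotient (R : realType) (n : nat) (F : R -> 'rV[R]_n -> R)
    (t : R) (x : 'rV[R]_n) (h : R) : R :=
  h^-1 * (F (t + h) x - F t x).

Definition dt_derivable (R : realType) (n : nat) (F : R -> 'rV[R]_n -> R)
    (t : R) (x : 'rV[R]_n) : Prop :=
  cvg (dt_quotient F t x @ time_incr t).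

Definition dt (R : realType) (n : nat) (F : R -> 'rV[R]_n -> R)
    (t : R) (x : 'rV[R]_n) : R :=
  lim (dt_quotient F t x @ time_incr t).

Definition time_domain (R : realType) (T : \bar R) : set R :=
  [set t | 0 <= t /\ (t%:E < T)%E].

Definition C1_spacetime (R : realType) (n : nat) (T : \bar R)
    (F : R -> 'rV[R]_n -> R) : Prop :=
  let D := time_domain T `*` @punctured R n in
  [/\ forall t x, D (t, x) -> dt_derivable F t x,
      {within D, continuous (fun p : R * 'rV[R]_n => dt F p.1 p.2)}
    & forall i : 'I_n,
        (forall t x, D (t, x) -> derivable (F t) x (std_basis R i)) /\
        {within D, continuous (fun p : R * 'rV[R]_n =>
           'D_(std_basis R i) (F p.1) p.2)}].

Definition C2_spacetime (R : realType) (n : nat) (T : \bar R)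
    (F : R -> 'rV[R]_n -> R) : Prop :=
  [/\ C1_spacetime T F,
      C1_spacetime T (dt F)
    & forall i : 'I_n,
        C1_spacetime T (fun t => 'D_(std_basis R i) (F t))].

Definition nonlinear_solution (R : realType) (n : nat)
    (u0 : 'rV[R]_n -> \bar R) (du0 : 'rV[R]_n -> R) (T : \bar R)
    (u : R -> 'rV[R]_n -> \bar R) : Prop :=
  let U := fun (t : R) (x : 'rV[R]_n) => fine (u t x) in
  [/\ C2_spacetime T U,
      forall t, time_domain T t -> S2 (u t) /\ nonlinear_at_infinity (u t),
      forall (t : R) (x : 'rV[R]_n), time_domain T t -> x != 0 ->
        dt (dt (fun s z => (U s z)^-1)) t x
          + quad_form (invmx (hessian (U t) x))
              (grad (fun z => dt U t z / U t z) x) = 0,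
      u 0 = u0
    & forall x, dt U 0 x = du0 x].

Definition polar_velocity (R : realType) (n : nat)
    (u0 : 'rV[R]_n -> \bar R) (du0 : 'rV[R]_n -> R) (y : 'rV[R]_n) : R :=
  if y == 0 then 0
  else du0 (polar_grad (polar u0) y) / fine (u0 (polar_grad (polar u0) y)).

Definition polar_flow (R : realType) (n : nat)
    (u0 : 'rV[R]_n -> \bar R) (du0 : 'rV[R]_n -> R) (t : R) (y : 'rV[R]_n)
    : \bar R :=
  (polar u0 y * (1 - t * polar_velocity u0 du0 y)%:E)%E.

(* The maximum with [0] only serves to give the value [0] when no [t > 0] is
   admissible. *)
Definition lifespan (R : realType) (n : nat)
    (u0 : 'rV[R]_n -> \bar R) (du0 : 'rV[R]_n -> R) : \bar R :=
  maxe 0%E (ereal_sup [set t%:E | t in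
    [set t : R | [/\ 0 < t, S2 (polar_flow u0 du0 t)
                   & nonlinear_at_infinity (polar_flow u0 du0 t)]]]).

(* Main.v *)
(* The point [x = X t y] maximizing [(<x, y> - 1) / f_t x] satisfies
   [grad f_t x = y / g_t y], where [g_t] is the polar of [f_t]; a Caratheodory
   version of the inverse function theorem makes [X] of class C^1, whence [g] is
   C^2 with [grad g_t y = x / f_t x] and [(dg/dt) / g = - V] at [x], with
   [V = (df/dt) / f].
   Differentiating [grad f_t (X t y) = y / g_t y] in time and using the equality
   of mixed partials gives [Hess f_t * dX/dt = - f_t grad V], and then
     d^2 g/dt^2 (y) = g f ( d^2 (1/f)/dt^2 + |grad V|^2_{(Hess f)^-1} ) (x).
   Hence [f] solves the equation iff its polar is affine in time, and polarity
   is an involution. *)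
Require Import Defs.
From mathcomp Require Import all_boot all_order all_algebra.
From mathcomp Require Import all_classical all_reals all_analysis.
From mathcomp Require Import ring lra.
Import Order.TTheory GRing.Theory Num.Theory.
Import numFieldNormedType.Exports.
Local Open Scope classical_set_scope.
Local Open Scope ring_scope.
Set Implicit Arguments.
Unset Strict Implicit.
Unset Printing Implicit Defensive.

(** * Calculus on spacetime *)

(** The interval [[0, T)] is closed on the left, so differentiability, the chain rule, the symmetry
    of mixed derivatives and implicit differentiation are all set up relative to nearby points with
    nonnegative time. Nonlinearity at infinity makes the intercepts of tangent planes unbounded
    along rays, locally uniformly in time; this confines the maximizers to compact sets and gives
    both their existence and their continuity in [(t, y)]. The maximizer is only C^1, but the first
    derivatives of the polar contain no derivative of it, so the polar is C^2. The velocity [v] is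
    composed with a maximizer and meets the same loss of regularity; there the second derivatives
    come from the flow at an admissible time [s], through a difference quotient. As [T] is merely a
    supremum, a time [t] below it is reached by writing the flow at [t] as a convex combination of
    the flows at [0] and at an admissible [s > t]. One identity for the second time derivative
    serves twice: existence applies it to the polar of the linear flow, uniqueness to a given
    solution. *)

Section SpaceTime.
Variables (R : realType) (n : nat) (T : \bar R).
Local Notation V := 'rV[R]_n.
Implicit Types (F G : R -> V -> R) (p q : R * V).

Definition spacetime : set (R * V) := time_domain T `*` @punctured R n.

(** At time 0 only nonnegative times are seen, in agreement with the one-sided increments of
    [time_incr]. *)
Definition near_st p : set_system (R * V) := within spacetime (nbhs p).

Global Instance near_st_filter p : Filter (near_st p).
Proof. exact: within_filter. Qed.

Lemma coord_le_norm (x : V) i : `|x 0 i| <= `|x|.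
Proof.
rewrite [leRHS]/Num.norm /= mx_normrE; apply/bigmax_geP; right => /=.
by exists (0, i).
Qed.

Lemma norm_le_coord (x : V) (r : R) : 0 <= r ->
  (forall i, `|x 0 i| <= r) -> `|x| <= r.
Proof.
move=> r0 h; rewrite /Num.norm /= mx_normrE; apply/bigmax_leP; split=> //= -[i j] _.
by rewrite (ord1 i).
Qed.

Lemma cvg_coord (I : Type) (FI : set_system I) (f : I -> V) (l : V) :
  Filter FI -> (forall i, f x 0 i @[x --> FI] --> l 0 i) -> f x @[x --> FI] --> l.
Proof.
move=> FF h; apply/cvgrPdist_le => e e0.
have : \forall x \near FI, forall i, `|l 0 i - f x 0 i| <= e.
  by apply: filter_forall => i; have /cvgrPdist_le/(_ _ e0) := h i.
apply: filterS => x hx; apply: norm_le_coord; first exact: ltW.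
by move=> i; rewrite !mxE; exact: hx.
Qed.

Lemma punctured_near (x : V) : x != 0 -> \forall z \near x, z != 0.
Proof.
move=> x0; apply/nbhs_ballP; exists `|x| => /=; first by rewrite normr_gt0.
move=> z; rewrite -ball_normE /=; apply: contraTneq => ->.
by rewrite subr0 ltxx.
Qed.

Lemma lt_lifetime_near (t : R) : (t%:E < T)%E -> \forall s \near t, (s%:E < T)%E.
Proof.
case: T => [r||] //.
- rewrite lte_fin => tr; have := @open_lt R r.
  by rewrite openE => /(_ t tr); apply: filterS => s; rewrite lte_fin.
- by move=> _; near=> s; rewrite ltry.
Unshelve. all: by end_near. Qed.

(** The conditions [t < T] and [x != 0] are open, hence automatic near [p]; only the nonnegativity
    of time has to be supplied. *)
Lemma cvg_near_st (I : Type) (FI : set_system I) (f : I -> R) (g : I -> V) p :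
  Filter FI -> spacetime p -> f x @[x --> FI] --> p.1 -> g x @[x --> FI] --> p.2 ->
  (\forall x \near FI, 0 <= f x) -> (f x, g x) @[x --> FI] --> near_st p.
Proof.
move=> FF [[_ pT] p0] cf cg f0 A [[B C] [/= hB hC] BCA].
have h1 := cf _ hB; have h2 := cg _ hC.
have h3 := cf _ (lt_lifetime_near pT); have h4 := cg _ (punctured_near p0).
suff : \forall x \near FI, A (f x, g x) by [].
near=> x; apply: (BCA (f x, g x)).
  split => /=; first by near: x; exact: h1.
  by near: x; exact: h2.
split; last by near: x; exact: h4.
by split; near: x; [exact: f0 | exact: h3].
Unshelve. all: by end_near. Qed.

Lemma near_st_cvg p : (q : R * V) @[q --> near_st p] --> p.
Proof. exact: cvg_within. Qed.

Lemma near_st_cvg1 p : q.1 @[q --> near_st p] --> p.1.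
Proof. exact: (cvg_comp _ _ (@near_st_cvg p) (@cvg_fst _ _ _ _ _)). Qed.

Lemma near_st_cvg2 p : q.2 @[q --> near_st p] --> p.2.
Proof. exact: (cvg_comp _ _ (@near_st_cvg p) (@cvg_snd _ _ _ _ _)). Qed.

Lemma near_st_in p : \forall q \near near_st p, spacetime q.
Proof. by rewrite /near_st near_withinE; apply: nearW. Qed.

Lemma near_st_coord p (i : 'I_n) : (fun q : R * V => q.2 0 i) @ near_st p --> p.2 0 i.
Proof.
apply: (@cvg_comp _ _ _ (fun q : R * V => q.2) (fun x : V => x 0 i)).
  exact: near_st_cvg2.
exact: coord_continuous.
Qed.

Lemma within_stP (Q : R * V -> R) : {within spacetime, continuous Q} <->
  (forall p, spacetime p -> Q q @[q --> near_st p] --> Q p).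
Proof. by split=> /subspace_continuousP. Qed.

(* Caratheodory form of differentiability at [p] relative to [spacetime]: the
   increment of [F] is written with slopes that converge at [p], so that chain
   and inverse rules become exact algebra. *)
Definition cdiff F p (a : R) (A : 'I_n -> R) : Prop :=
  exists (al : R * V -> R) (be : 'I_n -> R * V -> R),
  [/\ al q @[q --> near_st p] --> a,
      forall i, be i q @[q --> near_st p] --> A i
    & \forall q \near near_st p, F q.1 q.2 - F p.1 p.2 =
        (q.1 - p.1) * al q + \sum_(i < n) (q.2 0 i - p.2 0 i) * be i q].

Global Instance time_incr_filter (t : R) : Filter (time_incr t).
Proof. exact: within_filter. Qed.

Lemma time_incr_proper (t : R) : 0 <= t -> ProperFilter (time_incr t).
Proof.
move=> t0; split; last exact: time_incr_filter.
rewrite /time_incr /within /=; rewrite /dnbhs /within /=.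
move=> /nbhs_ballP [e /= e0 h].
have := h (e / 2).
rewrite /ball /= sub0r normrN gtr0_norm ?divr_gt0 // => /(_ _ _ _); apply.
- by rewrite ltr_pdivrMr // ltr_pMr // ltr1n.
- by rewrite gt_eqF // divr_gt0.
- by rewrite addr_ge0 // ltW // divr_gt0.
Qed.

Lemma time_incr_neq0 (t : R) : \forall h \near time_incr t, h != 0.
Proof.
by apply: (@cvg_within _ (0 : R)^' _ _); rewrite /dnbhs; exact: withinT.
Qed.

Lemma time_incr_ge0 (t : R) : \forall h \near time_incr t, 0 <= t + h.
Proof. by rewrite /time_incr near_withinE; apply: nearW. Qed.

Lemma time_incr_cvg (t : R) : h @[h --> time_incr t] --> (0 : R).
Proof.
have H : (h : R) @[h --> (0 : R)^'] --> (0 : R) by exact: cvg_within.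
by apply: cvg_trans H; exact: cvg_within.
Qed.

Lemma time_incr_st p : spacetime p ->
  (p.1 + h, p.2) @[h --> time_incr p.1] --> near_st p.
Proof.
move=> Dp; apply: cvg_near_st => //.
- rewrite -[X in _ --> X]addr0; apply: cvgD; [exact: cvg_cst|exact: time_incr_cvg].
- exact: cvg_cst.
- exact: time_incr_ge0.
Qed.

Lemma cdiff_cvg_dt F p a A : spacetime p -> cdiff F p a A ->
  dt_quotient F p.1 p.2 h @[h --> time_incr p.1] --> a.
Proof.
move=> Dp [al [be [ca cb E]]].
have c1 := cvg_comp _ _ (time_incr_st Dp) ca.
apply: cvg_trans c1; apply: near_eq_cvg.
have E1 := time_incr_st Dp E.
have E2 := time_incr_neq0 p.1.
near=> h.
have h0 : h != 0 by near: h; exact: E2.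
rewrite /dt_quotient.
have -> /= : F (p.1 + h) p.2 - F p.1 p.2 =
   ((p.1 + h) - p.1) * al (p.1 + h, p.2) + \sum_(i < n) (p.2 0 i - p.2 0 i) * be i (p.1 + h, p.2).
  by near: h; exact: E1.
rewrite big1 => [|i _]; last by rewrite subrr mul0r.
by rewrite addr0 [p.1 + h]addrC addrK mulKf.
Unshelve. all: by end_near. Qed.

Lemma cdiff_dt F p a A : spacetime p -> cdiff F p a A ->
  dt_derivable F p.1 p.2 /\ dt F p.1 p.2 = a.
Proof.
move=> Dp /(cdiff_cvg_dt Dp) H.
have PF : ProperFilter (time_incr p.1) by apply: time_incr_proper; case: Dp => -[].
split; first by apply/cvg_ex; exists a.
exact: cvg_lim.
Qed.

Lemma line_st p i : spacetime p ->
  (p.1, h *: std_basis R i + p.2) @[h --> (0 : R)^'] --> near_st p.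
Proof.
move=> Dp; apply: cvg_near_st => //.
- exact: cvg_cst.
- rewrite -[X in _ --> X]add0r; apply: cvgD; last exact: cvg_cst.
  rewrite -[X in _ --> X](scale0r (std_basis R i)); apply: cvgZl.
  exact: cvg_within.
- by apply: nearW; case: Dp => -[].
Qed.

Lemma cdiff_D F p a A i : spacetime p -> cdiff F p a A ->
  derivable (F p.1) p.2 (std_basis R i) /\ 'D_(std_basis R i) (F p.1) p.2 = A i.
Proof.
move=> Dp [al [be [ca cb E]]].
suff H : h^-1 *: ((F p.1 \o shift p.2) (h *: std_basis R i) - F p.1 p.2) @[h --> (0:R)^'] --> A i.
  split; first by apply/cvg_ex; exists (A i).
  exact: (cvg_lim _ H).
have c1 := cvg_comp _ _ (line_st i Dp) (cb i).
apply: cvg_trans c1; apply: near_eq_cvg.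
have E1 := line_st i Dp E.
near=> h.
have h0 : h != 0 by near: h; exact: nbhs_dnbhs_neq.
have -> /= : (F p.1 \o shift p.2) (h *: std_basis R i) - F p.1 p.2 =
   (p.1 - p.1) * al (p.1, h *: std_basis R i + p.2) +
   \sum_(j < n) ((h *: std_basis R i + p.2) 0 j - p.2 0 j) * be j (p.1, h *: std_basis R i + p.2).
  by near: h; exact: E1.
rewrite subrr mul0r add0r (bigD1 i) //= big1 => [|j ji]; last first.
  by rewrite !mxE eqxx (negbTE ji) /= mulr0 add0r subrr mul0r.
rewrite !mxE !eqxx /= mulr1 addrK addr0.
exact/esym/mulKf.
Unshelve. all: by end_near. Qed.

Lemma is_derive_line (f : V -> R) (z e : V) (s : R) :
  derivable f (z + s *: e) e ->
  is_derive s 1 (fun r : R => f (z + r *: e)) ('D_e f (z + s *: e)).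
Proof.
move=> df.
have E : (fun h : R => h^-1 *: (((fun r : R => f (z + r *: e)) \o shift s) (h *: (1 : R)) - f (z + s *: e)))
       = (fun h : R => h^-1 *: ((f \o shift (z + s *: e)) (h *: e) - f (z + s *: e))).
  apply/funext => h /=; congr (_ *: (f _ - _)).
  by rewrite [h *: _]mulr1 scalerDl addrCA.
by apply: DeriveDef; rewrite /derivable /derive E.
Qed.

Lemma mvt_line (f : V -> R) (z e : V) (d : R) :
  (forall s : R, `|s| <= `|d| -> derivable f (z + s *: e) e) ->
  exists2 s : R, `|s| <= `|d| & f (z + d *: e) - f z = d * 'D_e f (z + s *: e).
Proof.
move=> df; pose phi (r : R) := f (z + r *: e).
have dphi (s : R) : `|s| <= `|d| -> is_derive s 1 phi ('D_e f (z + s *: e)).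
  by move=> /df; exact: is_derive_line.
have cphi (A : set R) : (forall s, A s -> `|s| <= `|d|) -> {within A, continuous phi}.
  move=> hA; apply: continuous_in_subspaceT => s /set_mem /hA /dphi ds.
  by apply: differentiable_continuous; apply/derivable1_diffP.
have [d0|d0|->] := ltgtP d 0; last first.
- exists 0; first by rewrite normr0.
  by rewrite scale0r addr0 subrr mul0r.
- have [||c cI E] := @MVT _ phi (fun s => 'D_e f (z + s *: e)) 0 d d0.
  + move=> s; rewrite in_itv /= => /andP[s0 sd]; apply: dphi.
    by rewrite !gtr0_norm // ltW.
  + apply: cphi => s; rewrite /= in_itv /= => /andP[s0 sd].
    by rewrite !ger0_norm // ltW.
  + exists c.
      move: cI; rewrite in_itv /= => /andP[s0 sd].
      by rewrite !gtr0_norm // ltW.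
    by move: E; rewrite /phi scale0r addr0 subr0 mulrC.
- have [||c cI E] := @MVT _ phi (fun s => 'D_e f (z + s *: e)) d 0 d0.
  + move=> s; rewrite in_itv /= => /andP[s0 sd]; apply: dphi.
    by rewrite !ltr0_norm // lerN2 ltW.
  + apply: cphi => s; rewrite /= in_itv /= => /andP[s0 sd].
    by rewrite !ler0_norm // ?lerN2 // ltW.
  + exists c.
      move: cI; rewrite in_itv /= => /andP[s0 sd].
      by rewrite !ltr0_norm // lerN2 ltW.
    move: E; rewrite /phi scale0r addr0 sub0r => /(congr1 -%R).
    by rewrite opprB => ->; rewrite mulrN opprK mulrC.
Qed.

(** The corners of a path from [x] to [x'] that changes one coordinate at a time, so that the
    one-dimensional mean value theorem applies on each edge. *)
Definition splice (k : nat) (x x' : V) : V :=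
  \row_i (if (i < k)%N then x' 0 i else x 0 i).

Lemma splice0 x x' : splice 0 x x' = x.
Proof. by apply/rowP => i; rewrite mxE. Qed.

Lemma splicen x x' : splice n x x' = x'.
Proof. by apply/rowP => i; rewrite mxE ltn_ord. Qed.

Lemma spliceS (k : 'I_n) x x' :
  splice k.+1 x x' = splice k x x' + (x' 0 k - x 0 k) *: std_basis R k.
Proof.
apply/rowP => i; rewrite !mxE eqxx /= ltnS leq_eqVlt.
have [->|ik] := eqVneq i k; first by rewrite eqxx ltnn /= mulr1 addrC subrK.
by rewrite -val_eqE /= in ik; rewrite (negbTE ik) mulr0 addr0.
Qed.

(** In the sup norm this path never leaves the closed ball of radius [|x' - x|] around [x]; hence
    the intermediate points of the mean value theorem tend to [x] as [x'] does. *)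
Lemma splice_line_dist (k : 'I_n) (x x' : V) (s : R) : `|s| <= `|x' 0 k - x 0 k| ->
  `|splice k x x' + s *: std_basis R k - x| <= `|x' - x|.
Proof.
move=> hs; apply: norm_le_coord => // i; rewrite !mxE eqxx /=.
have [->|ik] := eqVneq i k.
  rewrite ltnn mulr1 addrC addrA addNr add0r (le_trans hs) //.
  by have := coord_le_norm (x' - x) k; rewrite !mxE.
rewrite mulr0 addr0; case: ifP => _; last by rewrite subrr normr0.
by have := coord_le_norm (x' - x) i; rewrite !mxE.
Qed.

(** Time moves first, at the fixed point [p.2], where the slope is the difference quotient itself;
    then the coordinates move one by one at the time [q.1], where the slopes are partial derivatives
    at intermediate points and converge by joint continuity. *)
Lemma C1_cdiff F p : C1_spacetime T F -> spacetime p ->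
  cdiff F p (dt F p.1 p.2) (fun i => 'D_(std_basis R i) (F p.1) p.2).
Proof.
move=> [Ct _ CD] Dp; have [[p1ge0 p1T] p20] := Dp.
pose al q := if q.1 == p.1 then dt F p.1 p.2 else (q.1 - p.1)^-1 * (F q.1 p.2 - F p.1 p.2).
pose good (i : 'I_n) q (xi : V) := `|xi - p.2| <= `|q.2 - p.2| /\
  F q.1 (splice i.+1 p.2 q.2) - F q.1 (splice i p.2 q.2) =
  (q.2 0 i - p.2 0 i) * 'D_(std_basis R i) (F q.1) xi.
(* The default [p.2] keeps [xi] within [|q.2 - p.2|] of [p.2] for every [q], even where no
   intermediate point exists. *)
pose xi i q := xget p.2 (good i q).
have xid i q : `|xi i q - p.2| <= `|q.2 - p.2|.
  by rewrite /xi; case: xgetP => [y _ []//|_]; rewrite subrr normr0.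
exists al, (fun i q => 'D_(std_basis R i) (F q.1) (xi i q)); split.
- have Hdt : dt_quotient F p.1 p.2 h @[h --> time_incr p.1] --> dt F p.1 p.2 by exact: (Ct p.1 p.2).
  apply/cvgrPdist_lt => e e0.
  move/cvgrPdist_lt : Hdt => /(_ _ e0) [/= d d0 hd].
  have : \forall q \near near_st p, `|p.1 - q.1| < d.
    by move: (@near_st_cvg1 p) => /cvgrPdist_lt /(_ _ d0).
  apply: filterS2 (near_st_in p) => q [[q10 _] _] qd.
  rewrite /al; case: eqVneq => [_|qp]; first by rewrite subrr normr0.
  have := hd (q.1 - p.1); rewrite /dt_quotient /ball /= sub0r opprB.
  rewrite [p.1 + _]addrC subrK; apply => //.
  by rewrite subr_eq0.
- move=> i; have H := (within_stP _).1 (CD i).2 p Dp.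
  apply: (@cvg_comp _ _ _ (fun q => (q.1, xi i q)) (fun q => 'D_(std_basis R i) (F q.1) q.2)) H.
  apply: cvg_near_st => //.
  + exact: near_st_cvg1.
  + apply/cvgrPdist_lt => e e0.
    move: (@near_st_cvg2 p) => /cvgrPdist_lt /(_ _ e0); apply: filterS => q.
    by apply: le_lt_trans; rewrite distrC (le_trans (xid _ _)) // distrC.
  + by apply: filterS (near_st_in p) => q [[]].
- have [r /= r0 hr] := (nbhs_ballP _ _).1 (punctured_near p20).
  have : \forall q \near near_st p, `|p.2 - q.2| < r.
    by move: (@near_st_cvg2 p) => /cvgrPdist_lt /(_ _ r0).
  apply: filterS2 (near_st_in p) => q [[q10 q1T] _] qr.
  have -> : F q.1 q.2 - F p.1 p.2 = (F q.1 p.2 - F p.1 p.2) + (F q.1 q.2 - F q.1 p.2) by ring.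
  congr (_ + _).
    rewrite /al; case: eqVneq => [->|qp]; first by rewrite !subrr mul0r.
    by rewrite mulVKf // subr_eq0.
  rewrite -{1}(splicen p.2 q.2) -{2}(splice0 p.2 q.2).
  rewrite -(@telescope_sumr _ 0 n (fun k => F q.1 (splice k p.2 q.2))) // big_mkord.
  apply: eq_bigr => i _.
  suff /(xgetPex p.2) [] : exists y, good i q y by [].
  have [|s sd E] := @mvt_line (F q.1) (splice i p.2 q.2) (std_basis R i) (q.2 0 i - p.2 0 i).
    move=> s hs; apply: (CD i).1; split; first by split.
    apply: hr; rewrite -ball_normE /= distrC.
    by apply: le_lt_trans (splice_line_dist hs) _; rewrite distrC.
  exists (splice i p.2 q.2 + s *: std_basis R i); split; first exact: splice_line_dist.
  by rewrite spliceS.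
Qed.

Lemma cvg_sumr (I : Type) (FI : set_system I) (m : nat) (f : 'I_m -> I -> R) (l : 'I_m -> R) :
  Filter FI -> (forall k, True -> f k x @[x --> FI] --> l k) ->
  \sum_(k < m) f k x @[x --> FI] --> \sum_(k < m) l k.
Proof.
move=> FF h; elim: m f l h => [|m IH] f l h.
  rewrite big_ord0 (_ : (fun x => _) = (fun=> 0)); first exact: cvg_cst.
  by apply/funext => x; rewrite big_ord0.
rewrite big_ord_recr /=.
rewrite (_ : (fun x => _) = (fun x => \sum_(k < m) f (widen_ord (leqnSn m) k) x + f ord_max x)).
  apply: cvgD; last exact: h.
  by apply: (IH (fun k => f (widen_ord (leqnSn m) k))) => k _; exact: h.
by apply/funext => x; rewrite big_ord_recr.
Qed.

Lemma cdiff_cvg F p a A : cdiff F p a A -> F q.1 q.2 @[q --> near_st p] --> F p.1 p.2.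
Proof.
move=> [al [be [ca cb E]]].
have : (F p.1 p.2 + ((q.1 - p.1) * al q + \sum_(i < n) (q.2 0 i - p.2 0 i) * be i q)) @[q --> near_st p]
   --> F p.1 p.2 + ((p.1 - p.1) * a + \sum_(i < n) (p.2 0 i - p.2 0 i) * A i).
  apply: cvgD; first exact: cvg_cst.
  apply: cvgD.
    by apply: cvgM => //; apply: cvgB; [exact: near_st_cvg1|exact: cvg_cst].
  apply: cvg_sumr => i _; apply: cvgM => //.
  by apply: cvgB; [exact: near_st_coord|exact: cvg_cst].
rewrite subrr mul0r add0r big1 => [|i _]; last by rewrite subrr mul0r.
rewrite addr0; apply: cvg_trans; apply: near_eq_cvg.
by apply: filterS E => q <-; rewrite addrC subrK.
Qed.

(** * Rules of differentiation and functions of class C^1 on spacetime *)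

Lemma cdiff_eq F G p a A : spacetime p -> (forall q, spacetime q -> F q.1 q.2 = G q.1 q.2) ->
  cdiff F p a A -> cdiff G p a A.
Proof.
move=> Dp FG [al [be [ca cb E]]]; exists al, be; split => //.
by apply: filterS2 (near_st_in p) E => q Dq; rewrite !FG.
Qed.

Lemma cdiff_cst (c : R) p : cdiff (fun _ _ => c) p 0 (fun=> 0).
Proof.
exists (fun=> 0), (fun _ _ => 0); split => [|i|]; [exact: cvg_cst..|].
by apply: nearW => q; rewrite subrr mulr0 big1 ?addr0 // => i _; rewrite mulr0.
Qed.

Lemma cdiff_coord (j : 'I_n) p : cdiff (fun _ x => x 0 j) p 0 (fun i => (i == j)%:R).
Proof.
exists (fun=> 0), (fun i _ => (i == j)%:R); split => [|i|]; [exact: cvg_cst..|].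
apply: nearW => q; rewrite mulr0 add0r (bigD1 j) //= eqxx mulr1 big1 ?addr0 //.
by move=> i /negbTE ->; rewrite mulr0.
Qed.

Lemma cdiffD F G p a A b B : cdiff F p a A -> cdiff G p b B ->
  cdiff (fun t x => F t x + G t x) p (a + b) (fun i => A i + B i).
Proof.
move=> [al [be [ca cb E]]] [al' [be' [ca' cb' E']]].
exists (fun q => al q + al' q), (fun i q => be i q + be' i q); split.
- exact: cvgD.
- by move=> i; apply: cvgD.
apply: filterS2 E E' => q E E'; rewrite opprD addrACA E E'.
rewrite addrACA -mulrDr -big_split /=; congr (_ + _).
by apply: eq_bigr => i _; rewrite mulrDr.
Qed.

Lemma cdiffM F G p a A b B : cdiff F p a A -> cdiff G p b B ->
  cdiff (fun t x => F t x * G t x) p (a * G p.1 p.2 + F p.1 p.2 * b)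
    (fun i => A i * G p.1 p.2 + F p.1 p.2 * B i).
Proof.
move=> dF dG; have cG := cdiff_cvg dG.
move: dF dG => [al [be [ca cb E]]] [al' [be' [ca' cb' E']]].
exists (fun q => al q * G q.1 q.2 + F p.1 p.2 * al' q),
  (fun i q => be i q * G q.1 q.2 + F p.1 p.2 * be' i q); split.
- apply: cvgD; apply: cvgM => //; exact: cvg_cst.
- by move=> i; apply: cvgD; apply: cvgM => //; exact: cvg_cst.
apply: filterS2 E E' => q E E'.
have -> : F q.1 q.2 * G q.1 q.2 - F p.1 p.2 * G p.1 p.2 =
  (F q.1 q.2 - F p.1 p.2) * G q.1 q.2 + F p.1 p.2 * (G q.1 q.2 - G p.1 p.2) by ring.
rewrite E E' mulrDl mulrDr addrACA; congr (_ + _); first by ring.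
rewrite mulr_suml mulr_sumr -big_split /=.
by apply: eq_bigr => i _; ring.
Qed.

Lemma cdiffV F p a A : F p.1 p.2 != 0 -> cdiff F p a A ->
  cdiff (fun t x => (F t x)^-1) p (- a / F p.1 p.2 ^+ 2)
    (fun i => - A i / F p.1 p.2 ^+ 2).
Proof.
move=> F0 dF; have cF := cdiff_cvg dF.
move: dF => [al [be [ca cb E]]].
have c2 : (F q.1 q.2 * F p.1 p.2)^-1 @[q --> near_st p] --> (F p.1 p.2 ^+ 2)^-1.
  rewrite expr2; apply: cvgV; first by rewrite mulf_neq0.
  by apply: cvgM => //; exact: cvg_cst.
exists (fun q => - al q * (F q.1 q.2 * F p.1 p.2)^-1),
  (fun i q => - be i q * (F q.1 q.2 * F p.1 p.2)^-1); split.
- by apply: cvgM => //; exact: cvgN.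
- by move=> i; apply: cvgM => //; exact: cvgN.
have : \forall q \near near_st p, F q.1 q.2 != 0.
  exact: (cvgr_neq0 _ cF).
apply: filterS2 E => q E Fq.
have -> : (F q.1 q.2)^-1 - (F p.1 p.2)^-1 =
  - (F q.1 q.2 - F p.1 p.2) * (F q.1 q.2 * F p.1 p.2)^-1 by field; rewrite F0 Fq.
rewrite E opprD mulrDl; congr (_ + _); first by ring.
rewrite -sumrN mulr_suml; apply: eq_bigr => i _; ring.
Qed.

Lemma cdiff_sum (m : nat) (F : 'I_m -> R -> V -> R) p (a : 'I_m -> R) (A : 'I_m -> 'I_n -> R) :
  (forall k, cdiff (F k) p (a k) (A k)) ->
  cdiff (fun t x => \sum_(k < m) F k t x) p (\sum_k a k) (fun i => \sum_k A k i).
Proof.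
move=> /(_ _)/cid h.
pose al k := projT1 (h k); pose be k := projT1 (cid (projT2 (h k))).
have hh k : [/\ al k q @[q --> near_st p] --> a k,
      forall i, be k i q @[q --> near_st p] --> A k i
    & \forall q \near near_st p, F k q.1 q.2 - F k p.1 p.2 =
        (q.1 - p.1) * al k q + \sum_(i < n) (q.2 0 i - p.2 0 i) * be k i q].
  exact: (projT2 (cid (projT2 (h k)))).
exists (fun q => \sum_k al k q), (fun i q => \sum_k be k i q); split.
- by apply: cvg_sumr => k _; case: (hh k).
- by move=> i; apply: cvg_sumr => k _; case: (hh k) => _ /(_ i).
have : \forall q \near near_st p, forall k, F k q.1 q.2 - F k p.1 p.2 =
        (q.1 - p.1) * al k q + \sum_(i < n) (q.2 0 i - p.2 0 i) * be k i q.
  by apply: filter_forall => k; case: (hh k).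
apply: filterS => q E; rewrite -sumrB (eq_bigr _ (fun k _ => E k)) big_split /= -mulr_sumr.
congr (_ + _); rewrite exchange_big /=; apply: eq_bigr => i _.
by rewrite mulr_sumr.
Qed.

(** The slopes of [F], evaluated at the moving point [(q.1, X q.1 q.2)], are multiplied by the
    slopes of the coordinates of [X]; no remainder has to be estimated. *)
Lemma cdiff_comp F (X : R -> V -> V) p a A (b : 'I_n -> R) (B : 'I_n -> 'I_n -> R) :
  spacetime p -> (forall q, spacetime q -> X q.1 q.2 != 0) ->
  cdiff F (p.1, X p.1 p.2) a A ->
  (forall j, cdiff (fun t x => X t x 0 j) p (b j) (B j)) ->
  cdiff (fun t x => F t (X t x)) p (a + \sum_j b j * A j)
    (fun i => \sum_j B j i * A j).
Proof.
move=> Dp X0 dF dX.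
have cX : (q.1, X q.1 q.2) @[q --> near_st p] --> near_st (p.1, X p.1 p.2).
  have [[p10 p1T] p20] := Dp.
  apply: cvg_near_st => //=.
  - by split => //; apply: X0.
  - exact: near_st_cvg1.
  - by apply: cvg_coord => i; exact: (cdiff_cvg (dX i)).
  - by apply: filterS (near_st_in p) => q [[]].
move: dF dX => [al [be [ca cb E]]] /(_ _)/cid h.
pose al' k := projT1 (h k); pose be' k := projT1 (cid (projT2 (h k))).
have hh k : [/\ al' k q @[q --> near_st p] --> b k,
      forall i, be' k i q @[q --> near_st p] --> B k i
    & \forall q \near near_st p, X q.1 q.2 0 k - X p.1 p.2 0 k =
        (q.1 - p.1) * al' k q + \sum_(i < n) (q.2 0 i - p.2 0 i) * be' k i q].
  exact: (projT2 (cid (projT2 (h k)))).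
have ca1 := cvg_comp _ _ cX ca.
have cb1 i := cvg_comp _ _ cX (cb i).
exists (fun q => al (q.1, X q.1 q.2) + \sum_j al' j q * be j (q.1, X q.1 q.2)),
  (fun i q => \sum_j be' j i q * be j (q.1, X q.1 q.2)); split.
- apply: cvgD => //; apply: cvg_sumr => j _; apply: cvgM; last exact: cb1.
  by case: (hh j).
- move=> i; apply: cvg_sumr => j _; apply: cvgM; last exact: cb1.
  by case: (hh j) => _ /(_ i).
have : \forall q \near near_st p, forall k, X q.1 q.2 0 k - X p.1 p.2 0 k =
        (q.1 - p.1) * al' k q + \sum_(i < n) (q.2 0 i - p.2 0 i) * be' k i q.
  by apply: filter_forall => k; case: (hh k).
have E' : \forall q \near near_st p, F q.1 (X q.1 q.2) - F p.1 (X p.1 p.2) =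
    (q.1 - p.1) * al (q.1, X q.1 q.2) +
    \sum_(i < n) (X q.1 q.2 0 i - X p.1 p.2 0 i) * be i (q.1, X q.1 q.2) := cX _ E.
apply: filterS2 E' => q Eq EX; rewrite Eq mulrDr -addrA; congr (_ + _).
rewrite (eq_bigr (fun j => (q.1 - p.1) * (al' j q * be j (q.1, X q.1 q.2)) +
   \sum_(i < n) (q.2 0 i - p.2 0 i) * (be' j i q * be j (q.1, X q.1 q.2)))); last first.
  move=> j _; rewrite EX mulrDl mulrA; congr (_ + _); rewrite mulr_suml.
  by apply: eq_bigr => i _; rewrite mulrA.
rewrite big_split /= -mulr_sumr; congr (_ + _).
by rewrite exchange_big /=; apply: eq_bigr => i _; rewrite mulr_sumr.
Qed.

Lemma cdiff_time p : cdiff (fun t _ => t) p 1 (fun=> 0).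
Proof.
exists (fun=> 1), (fun _ _ => 0); split => [|i|]; [exact: cvg_cst..|].
by apply: nearW => q; rewrite mulr1 big1 ?addr0 // => i _; rewrite mulr0.
Qed.

(** Class C^1 is proved by exhibiting candidate derivatives: [cdiff] identifies them with [dt] and
    the partial derivatives on [spacetime], the only place where continuity is tested. *)
Lemma C1_intro F (a : R * V -> R) (A : 'I_n -> R * V -> R) :
  (forall p, spacetime p -> cdiff F p (a p) (A^~ p)) ->
  (forall p, spacetime p -> a q @[q --> near_st p] --> a p) ->
  (forall i p, spacetime p -> A i q @[q --> near_st p] --> A i p) ->
  C1_spacetime T F.
Proof.
move=> dF ca cA; split.
- by move=> t x Dp; exact: (cdiff_dt Dp (dF _ Dp)).1.
- apply/within_stP => p Dp; rewrite (cdiff_dt Dp (dF _ Dp)).2.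
  apply: cvg_trans (ca p Dp); apply: near_eq_cvg.
  by apply: filterS (near_st_in p) => q Dq; rewrite (cdiff_dt Dq (dF _ Dq)).2.
- move=> i; split => [t x Dp|]; first exact: (cdiff_D i Dp (dF _ Dp)).1.
  apply/within_stP => p Dp; rewrite (cdiff_D i Dp (dF _ Dp)).2.
  apply: cvg_trans (cA i p Dp); apply: near_eq_cvg.
  by apply: filterS (near_st_in p) => q Dq; rewrite (cdiff_D i Dq (dF _ Dq)).2.
Qed.

Lemma C1_cvg F p : C1_spacetime T F -> spacetime p -> F q.1 q.2 @[q --> near_st p] --> F p.1 p.2.
Proof. by move=> CF Dp; exact: cdiff_cvg (C1_cdiff CF Dp). Qed.

Lemma C1_cvg_dt F p : C1_spacetime T F -> spacetime p ->
  dt F q.1 q.2 @[q --> near_st p] --> dt F p.1 p.2.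
Proof. by move=> [_ c _] Dp; exact: (within_stP _).1 c p Dp. Qed.

Lemma C1_cvg_D F i p : C1_spacetime T F -> spacetime p ->
  'D_(std_basis R i) (F q.1) q.2 @[q --> near_st p] --> 'D_(std_basis R i) (F p.1) p.2.
Proof. by move=> [_ _ c] Dp; exact: (within_stP _).1 (c i).2 p Dp. Qed.

Lemma C1_eq F G : (forall q, spacetime q -> F q.1 q.2 = G q.1 q.2) ->
  C1_spacetime T F -> C1_spacetime T G.
Proof.
move=> FG CF; apply: (@C1_intro _ (fun q => dt F q.1 q.2) (fun i q => 'D_(std_basis R i) (F q.1) q.2)).
- by move=> p Dp; apply: (cdiff_eq Dp FG); exact: C1_cdiff.
- by move=> p Dp; exact: C1_cvg_dt.
- by move=> i p Dp; exact: C1_cvg_D.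
Qed.

Lemma C1_cst (c : R) : C1_spacetime T (fun _ (_ : V) => c).
Proof.
apply: (@C1_intro _ (fun=> 0) (fun _ _ => 0)).
- by move=> p _; exact: cdiff_cst.
- by move=> p _; exact: cvg_cst.
- by move=> i p _; exact: cvg_cst.
Qed.

Lemma C1_time : C1_spacetime T (fun t (_ : V) => t).
Proof.
apply: (@C1_intro _ (fun=> 1) (fun _ _ => 0)).
- by move=> p _; exact: cdiff_time.
- by move=> p _; exact: cvg_cst.
- by move=> i p _; exact: cvg_cst.
Qed.

Lemma C1_coord (j : 'I_n) : C1_spacetime T (fun _ (x : V) => x 0 j).
Proof.
apply: (@C1_intro _ (fun=> 0) (fun i _ => (i == j)%:R)).
- by move=> p _; exact: cdiff_coord.
- by move=> p _; exact: cvg_cst.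
- by move=> i p _; exact: cvg_cst.
Qed.

Lemma C1D F G : C1_spacetime T F -> C1_spacetime T G ->
  C1_spacetime T (fun t x => F t x + G t x).
Proof.
move=> CF CG; apply: C1_intro.
- by move=> p Dp; apply: cdiffD; exact: C1_cdiff.
- by move=> p Dp; apply: cvgD; exact: C1_cvg_dt.
- by move=> i p Dp; apply: cvgD; exact: C1_cvg_D.
Qed.

Lemma C1M F G : C1_spacetime T F -> C1_spacetime T G ->
  C1_spacetime T (fun t x => F t x * G t x).
Proof.
move=> CF CG; apply: C1_intro.
- by move=> p Dp; apply: cdiffM; exact: C1_cdiff.
- move=> p Dp; apply: cvgD; apply: cvgM;
    by [exact: C1_cvg_dt | exact: C1_cvg].
- move=> i p Dp; apply: cvgD; apply: cvgM;
    by [exact: C1_cvg_D | exact: C1_cvg].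
Qed.

Lemma C1V F : (forall p, spacetime p -> F p.1 p.2 != 0) -> C1_spacetime T F ->
  C1_spacetime T (fun t x => (F t x)^-1).
Proof.
move=> F0 CF.
have c2 p : spacetime p -> (F q.1 q.2 ^+ 2)^-1 @[q --> near_st p] --> (F p.1 p.2 ^+ 2)^-1.
  move=> Dp; rewrite expr2; apply: cvgV; first by rewrite mulf_neq0 // F0.
  by under eq_fun do rewrite expr2; apply: cvgM; exact: C1_cvg.
apply: C1_intro.
- by move=> p Dp; apply: cdiffV; [exact: F0|exact: C1_cdiff].
- by move=> p Dp; apply: cvgM; [apply: cvgN; exact: C1_cvg_dt|exact: c2].
- by move=> i p Dp; apply: cvgM; [apply: cvgN; exact: C1_cvg_D|exact: c2].
Qed.

Lemma C1_sum (m : nat) (F : 'I_m -> R -> V -> R) : (forall k, C1_spacetime T (F k)) ->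
  C1_spacetime T (fun t x => \sum_(k < m) F k t x).
Proof.
move=> CF; apply: C1_intro.
- by move=> p Dp; apply: cdiff_sum => k; exact: C1_cdiff.
- by move=> p Dp; apply: cvg_sumr => k _; exact: C1_cvg_dt.
- by move=> i p Dp; apply: cvg_sumr => k _; exact: C1_cvg_D.
Qed.

Lemma C1N F : C1_spacetime T F -> C1_spacetime T (fun t x => - F t x).
Proof.
move=> CF; apply: (@C1_eq (fun t x => -1 * F t x)).
  by move=> q _; rewrite mulN1r.
by apply: C1M => //; exact: C1_cst.
Qed.

(** Stands for the time-preserving map [(t, x) -> (t, X t x)]; avoiding 0 keeps its values in
    [spacetime]. *)
Definition C1_map (X : R -> V -> V) : Prop :=
  (forall q, spacetime q -> X q.1 q.2 != 0) /\ forall j, C1_spacetime T (fun t x => X t x 0 j).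

Lemma C1_map_cvg X p : C1_map X -> spacetime p ->
  (q.1, X q.1 q.2) @[q --> near_st p] --> near_st (p.1, X p.1 p.2).
Proof.
move=> [X0 CX] Dp; have [[p10 p1T] p20] := Dp; apply: cvg_near_st => //=.
- by split => //; apply: X0.
- exact: near_st_cvg1.
- by apply: cvg_coord => i; exact: (C1_cvg (CX i) Dp).
- by apply: filterS (near_st_in p) => q [[]].
Qed.

Lemma C1_map_st X p : C1_map X -> spacetime p -> spacetime (p.1, X p.1 p.2).
Proof. by move=> [X0 _] Dp; split; [case: Dp|exact: X0]. Qed.

Lemma C1_map_comp_cvg (Q : R * V -> R) X p (l : R) : C1_map X -> spacetime p ->
  Q q @[q --> near_st (p.1, X p.1 p.2)] --> l ->
  Q (q.1, X q.1 q.2) @[q --> near_st p] --> l.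
Proof. by move=> CX Dp; apply: cvg_comp; exact: C1_map_cvg. Qed.

Lemma C1_comp_cdiff F X p : C1_spacetime T F -> C1_map X -> spacetime p ->
  cdiff (fun t x => F t (X t x)) p
    (dt F p.1 (X p.1 p.2) + \sum_j dt (fun t x => X t x 0 j) p.1 p.2 * 'D_(std_basis R j) (F p.1) (X p.1 p.2))
    (fun i => \sum_j 'D_(std_basis R i) (fun x => X p.1 x 0 j) p.2 * 'D_(std_basis R j) (F p.1) (X p.1 p.2)).
Proof.
move=> CF CX Dp; apply: cdiff_comp => //; first exact: CX.1.
- exact: (C1_cdiff CF (C1_map_st CX Dp)).
- by move=> j; exact: (C1_cdiff (CX.2 j) Dp).
Qed.

Lemma C1_comp F X : C1_spacetime T F -> C1_map X -> C1_spacetime T (fun t x => F t (X t x)).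
Proof.
move=> CF CX; apply: C1_intro.
- by move=> p Dp; exact: C1_comp_cdiff.
- move=> p Dp; apply: cvgD.
    exact: (cvg_comp _ _ (C1_map_cvg CX Dp) (C1_cvg_dt CF (C1_map_st CX Dp))).
  apply: cvg_sumr => j _; apply: cvgM; first exact: (C1_cvg_dt (CX.2 j) Dp).
  exact: (C1_map_comp_cvg CX Dp (C1_cvg_D CF (C1_map_st CX Dp))).
- move=> i p Dp.
  apply: cvg_sumr => j _; apply: cvgM; first exact: (C1_cvg_D (CX.2 j) Dp).
  exact: (C1_map_comp_cvg CX Dp (C1_cvg_D CF (C1_map_st CX Dp))).
Qed.

(** The interval may start at time 0: the mean value theorem needs derivatives only in the open
    interval, where [dt] is two-sided, and continuity at the endpoints. *)
Lemma time_mvt G (t t' : R) (x : V) : C1_spacetime T G -> spacetime (t, x) -> spacetime (t', x) ->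
  t < t' -> exists2 s, t <= s <= t' & G t' x - G t x = (t' - t) * dt G s x.
Proof.
move=> CG [[t0 tT] x0] [[t'0 t'T] _] tt'.
have st s : t <= s -> s <= t' -> spacetime (s, x).
  move=> ts st'; split => //; split; first exact: le_trans ts.
  by apply: le_lt_trans t'T; rewrite lee_fin.
have [||c cI E] := @MVT _ (G^~ x) (fun s => dt G s x) t t' tt'.
- move=> s; rewrite in_itv /= => /andP[ts st'].
  have := cdiff_cvg_dt (st _ (ltW ts) (ltW st')) (C1_cdiff CG (st _ (ltW ts) (ltW st'))) => /= H.
  have s0 : 0 < s by apply: le_lt_trans ts.
  suff H' : h^-1 *: ((G^~ x \o shift s) (h *: (1 : R)) - G s x) @[h --> (0:R)^'] --> dt G s x.
    by apply: DeriveDef; [apply/cvg_ex; eexists; exact: H'|exact: (cvg_lim _ H')].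
  (* As [s > 0], all small increments keep the time nonnegative, so the restriction in [time_incr]
     disappears. *)
  have E : (0 : R)^' `=>` time_incr s.
    move=> B hB; have : \forall h \near (0 : R)^', 0 <= s + h.
      apply: nbhs_dnbhs; apply/nbhs_ballP; exists s => //= h.
      by rewrite /ball /= sub0r normrN => /ltr_normlP[]; lra.
    have hB' : \forall h \near (0 : R)^', 0 <= s + h -> B h by exact: hB.
    by move=> H0; apply: filterS2 hB' H0 => h; apply.
  have H2 := cvg_trans (cvg_app (dt_quotient G s x) E) H.
  apply: cvg_trans H2; apply: near_eq_cvg; apply: nearW => h /=.
  by rewrite /dt_quotient [h *: _]mulr1 [h + s]addrC.
- apply/subspace_continuousP => s; rewrite /= in_itv /= => /andP[ts st'].
  have := C1_cvg CG (st _ ts st') => /= H.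
  apply: (@cvg_comp _ _ _ (fun r : R => (r, x)) (fun q : R * V => G q.1 q.2)) H.
  apply: cvg_near_st => //=; [exact: st|exact: cvg_within|exact: cvg_cst|].
  rewrite near_withinE; apply: nearW => r; rewrite /= in_itv /= => /andP[tr _].
  exact: le_trans tr.
- exists c; last by rewrite mulrC.
  by move: cI; rewrite in_itv /= => /andP[a b]; rewrite !ltW.
Qed.

(** The mixed second difference of [F] over a small rectangle is evaluated by mean values in both
    orders; each gives a mixed derivative near [p], and both are continuous at [p]. *)
Lemma schwarz_st F i p : C2_spacetime T F -> spacetime p ->
  dt (fun t => 'D_(std_basis R i) (F t)) p.1 p.2 = 'D_(std_basis R i) (dt F p.1) p.2.
Proof.
move=> [CF CdF /(_ i) CDF] Dp; have [[p10 p1T] p20] := Dp.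
have [f1 f1E] : exists f1 : R * V -> R, forall q, f1 q = dt (fun t => 'D_(std_basis R i) (F t)) q.1 q.2.
  by eexists => q; reflexivity.
have [f2 f2E] : exists f2 : R * V -> R, forall q, f2 q = 'D_(std_basis R i) (dt F q.1) q.2.
  by eexists => q; reflexivity.
have c1 : f1 q @[q --> near_st p] --> f1 p.
  by rewrite f1E; under eq_fun do rewrite f1E; exact: C1_cvg_dt.
have c2 : f2 q @[q --> near_st p] --> f2 p.
  by rewrite f2E; under eq_fun do rewrite f2E; exact: C1_cvg_D.
rewrite -f1E -f2E; apply/eqP; rewrite -subr_eq0 -normr_le0.
apply/ler_addgt0Pr => e e0; rewrite add0r.
have e20 : 0 < e / 2 by rewrite divr_gt0.
have : \forall q \near near_st p, [/\ `|f1 p - f1 q| < e / 2, `|f2 p - f2 q| < e / 2 & spacetime q].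
  move/cvgrPdist_lt : c1 => /(_ _ e20); move/cvgrPdist_lt : c2 => /(_ _ e20) H2 H1.
  by apply: filterS3 H1 H2 (near_st_in p) => q h1 h2 h3; split.
rewrite {1}/near_st near_withinE => -[[B C] /= [hB hC] BC].
have hB' : nbhs p.1 (B `&` (fun s : R => (s%:E < T)%E)).
  by apply: filterI => //; exact: lt_lifetime_near.
have hC' : nbhs p.2 (C `&` (fun s : V => s != 0)).
  by apply: filterI => //; exact: punctured_near.
have /nbhs_ballP [d1 /= d10 hd1] := hB'.
have /nbhs_ballP [d2 /= d20 hd2] := hC'.
pose d := Num.min d1 d2.
have d0 : 0 < d by rewrite lt_min d10.
(* The rectangle extends only forward in time, so that it lies in the domain even when [p.1 = 0]. *)
have good (t : R) (x : V) : p.1 <= t -> t < p.1 + d -> `|x - p.2| < d ->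
   [/\ `|f1 p - f1 (t, x)| < e / 2, `|f2 p - f2 (t, x)| < e / 2 & spacetime (t, x)].
  move=> pt td xd.
  have [Bt tT] : (B `&` (fun s : R => (s%:E < T)%E)) t.
    apply: hd1; rewrite /ball /= distrC ger0_norm ?subr_ge0 //.
    by move: td; rewrite /d; case: (leP d1 d2) => *; lra.
  have [Cx x0] : (C `&` (fun s : V => s != 0)) x.
    apply: hd2; rewrite -ball_normE /= distrC.
    by apply: lt_le_trans xd _; rewrite ge_min lexx orbT.
  apply: (BC (t, x)) => //; split => //; split => //=.
  exact: le_trans pt.
pose h := d / 2.
have h0 : 0 < h by rewrite divr_gt0.
have hd : h < d by rewrite /h; lra.
pose e_ := std_basis R i.
have en : `|e_| <= 1.
  apply: norm_le_coord => // j; rewrite !mxE /=.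
  by case: (j == i); rewrite ?normr0 ?normr1.
have xs (s : R) : `|s| <= `|h| -> `|p.2 + s *: e_ - p.2| < d.
  rewrite (ger0_norm (ltW h0)) => sh.
  rewrite addrAC subrr add0r normrZ; apply: le_lt_trans hd.
  by rewrite -[h]mulr1; exact: ler_pM.
have g0 (s : R) : `|s| <= `|h| -> spacetime (p.1, p.2 + s *: e_).
  by move=> sh; case: (good p.1 (p.2 + s *: e_)) => //; [rewrite ltrDl|exact: xs].
have gh (s : R) : `|s| <= `|h| -> spacetime (p.1 + h, p.2 + s *: e_).
  by move=> sh; case: (good (p.1 + h) (p.2 + s *: e_)) => //;
   [rewrite lerDl ltW|rewrite ltrD2l|exact: xs].
have pph : p.1 < p.1 + h by rewrite ltrDl.
pose Delta := F (p.1 + h) (p.2 + h *: e_) - F p.1 (p.2 + h *: e_) - (F (p.1 + h) p.2 - F p.1 p.2).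
have E1 : exists2 q, `|f1 p - f1 q| < e / 2 & Delta = h * (h * f1 q).
  have dF q : spacetime q -> derivable (F q.1) q.2 e_ by move=> Dq; exact: (cdiff_D i Dq (C1_cdiff CF Dq)).1.
  have [|s sh E] := @mvt_line (fun z => F (p.1 + h) z - F p.1 z) p.2 e_ h.
    by move=> s sh; apply: derivableB; [exact: (dF _ (gh s sh))|exact: (dF _ (g0 s sh))].
  have [r /andP[r1 r2] Er] := time_mvt CDF (g0 s sh) (gh s sh) pph.
  exists (r, p.2 + s *: e_).
    by case: (good r (p.2 + s *: e_)) => //; [apply: (le_lt_trans r2); rewrite ltrD2l|exact: xs].
  rewrite /Delta E deriveB; [|exact: (dF _ (gh s sh))|exact: (dF _ (g0 s sh))].
  by rewrite Er f1E addrAC subrr add0r.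
have E2 : exists2 q, `|f2 p - f2 q| < e / 2 & Delta = h * (h * f2 q).
  have p20' : (p.2 + h *: e_) != 0 by have [//|_] := gh h.
  (* The spatial increment, as a function of time alone, is viewed as a spacetime function constant
     in space so that [time_mvt] applies to it. *)
  have Ccst x : x != 0 -> C1_map (fun _ _ => x).
    by move=> x0; split; [move=> q _; exact: x0|move=> j; exact: C1_cst].
  have CG x : x != 0 -> C1_spacetime T (fun t (_ : V) => F t x).
    by move=> x0; exact: (C1_comp CF (Ccst _ x0)).
  have dG : C1_spacetime T (fun t (_ : V) => F t (p.2 + h *: e_) - F t p.2).
    by apply: C1D; [exact: CG|apply: C1N; exact: CG].
  have s0 : spacetime (p.1, p.2) by split.
  have sh : spacetime (p.1 + h, p.2).
    by case: (good (p.1 + h) p.2) => //; rewrite ?subrr ?normr0 // ?ltrD2l // ltW.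
  have [r /andP[r1 r2] Er] := time_mvt dG s0 sh pph.
  have rd : r < p.1 + d by apply: (le_lt_trans r2); rewrite ltrD2l.
  have sr (s : R) : `|s| <= `|h| -> spacetime (r, p.2 + s *: e_).
    by move=> sh'; case: (good r (p.2 + s *: e_)) => //; exact: xs.
  have sr0 : spacetime (r, p.2) by case: (good r p.2) => //; rewrite subrr normr0.
  have [|s sh' E] := @mvt_line (dt F r) p.2 e_ h.
    by move=> s /sr Ds; exact: (cdiff_D i Ds (C1_cdiff CdF Ds)).1.
  exists (r, p.2 + s *: e_).
    by case: (good r (p.2 + s *: e_)) => //; exact: xs.
  have -> : Delta = F (p.1 + h) (p.2 + h *: e_) - F (p.1 + h) p.2
      - (F p.1 (p.2 + h *: e_) - F p.1 p.2) by rewrite /Delta; ring.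
  rewrite Er addrAC subrr add0r; congr (_ * _).
  rewrite f2E -E.
  have d1' := cdiffD (C1_cdiff (CG _ p20') sr0) (cdiffM (cdiff_cst (-1) (r, p.2)) (C1_cdiff (CG _ p20) sr0)).
  have d2' := cdiff_eq sr0 (G := fun t (_ : V) => F t (p.2 + h *: e_) - F t p.2) _ d1'.
  rewrite (cdiff_dt sr0 (d2' _)).2; last by move=> q _; rewrite mulN1r.
  by rewrite mul0r add0r mulN1r.
have [q1 h1 E1'] := E1; have [q2 h2 E2'] := E2.
have E : f1 q1 = f2 q2.
  by move: E1'; rewrite E2' => /(mulfI (lt0r_neq0 h0)) /(mulfI (lt0r_neq0 h0)).
have -> : f1 p - f2 p = (f1 p - f1 q1) - (f2 p - f2 q2) by rewrite E; ring.
apply: le_trans (ler_normB _ _) _; rewrite [e]splitr.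
by apply: ltW; apply: ltrD.
Qed.

End SpaceTime.

(** * Convex analysis of the polar transform *)

Section Dot.
Variables (R : realType) (n : nat).
Local Notation V := 'rV[R]_n.
Implicit Types x y z : V.

Lemma dotC x y : dot x y = dot y x.
Proof. by apply: eq_bigr => i _; rewrite mulrC. Qed.

Lemma dotDl x y z : dot (x + y) z = dot x z + dot y z.
Proof. by rewrite -big_split; apply: eq_bigr => i _; rewrite mxE mulrDl. Qed.

Lemma dotZl (a : R) x y : dot (a *: x) y = a * dot x y.
Proof. by rewrite mulr_sumr; apply: eq_bigr => i _; rewrite mxE mulrA. Qed.

Lemma dotBl x y z : dot (x - y) z = dot x z - dot y z.
Proof. by rewrite -[- y]scaleN1r dotDl dotZl mulN1r. Qed.

Lemma dotDr x y z : dot z (x + y) = dot z x + dot z y.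
Proof. by rewrite dotC dotDl !(dotC z). Qed.

Lemma dotZr (a : R) x y : dot x (a *: y) = a * dot x y.
Proof. by rewrite dotC dotZl dotC. Qed.

Lemma dot0l y : dot 0 y = 0.
Proof. by rewrite -(scale0r 0) dotZl mul0r. Qed.

Lemma dot0r y : dot y 0 = 0.
Proof. by rewrite dotC dot0l. Qed.

Lemma dot_gt0 y : y != 0 -> 0 < dot y y.
Proof.
move=> y0; have h : 0 <= dot y y by apply: sumr_ge0 => i _; rewrite -expr2 sqr_ge0.
rewrite lt_neqAle h andbT eq_sym; apply: contra y0 => /eqP H.
apply/eqP/rowP => i; rewrite mxE.
have /(_ _ H i isT) := @psumr_eq0P _ _ predT (fun i => y 0 i * y 0 i).
rewrite -expr2 => H'; apply/eqP; rewrite -sqrf_eq0; apply/eqP/H' => j _.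
by rewrite -expr2 sqr_ge0.
Qed.

Lemma dot_std i y : dot (std_basis R i) y = y 0 i.
Proof.
rewrite /dot (bigD1 i) //= mxE !eqxx mul1r big1 ?addr0 // => j /negbTE ji.
by rewrite mxE ji andbF mul0r.
Qed.

Lemma dot_le x y : `|dot x y| <= n%:R * (`|x| * `|y|).
Proof.
apply: le_trans (ler_norm_sum _ _ _) _.
have -> : n%:R * (`|x| * `|y|) = \sum_(i < n) (`|x| * `|y|).
  by rewrite sumr_const card_ord mulr_natl.
apply: ler_sum => i _; rewrite normrM; apply: ler_pM => //; exact: coord_le_norm.
Qed.

Lemma cvg_dot (I : Type) (FI : set_system I) (f g : I -> V) (l m : V) : Filter FI ->
  (forall i, f x 0 i @[x --> FI] --> l 0 i) -> (forall i, g x 0 i @[x --> FI] --> m 0 i) ->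
  dot (f x) (g x) @[x --> FI] --> dot l m.
Proof. by move=> FF cf cg; apply: cvg_sumr => i _; apply: cvgM. Qed.

End Dot.

(** * Strictly convex functions, their tangent planes and the maximizers of the polar *)

Section Static.
Variables (R : realType) (n : nat).
Local Notation V := 'rV[R]_n.
Implicit Types (f : V -> R) (u : V -> \bar R) (x y z : V).

Lemma punctured_st x t : x != 0 -> 0 <= t -> spacetime (+oo%E : \bar R) (t, x).
Proof. by move=> x0 t0; split => //; split => //=; exact: ltry. Qed.

Lemma dt_const f t x : 0 <= t -> dt (fun=> f) t x = 0.
Proof.
move=> t0; have PF := time_incr_proper t0.
apply: cvg_lim => //; rewrite (_ : dt_quotient _ _ _ = fun=> 0); first exact: cvg_cst.
by apply/funext => h; rewrite /dt_quotient subrr mulr0.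
Qed.

(** A function of space is treated as a family constant in time, which makes the spacetime calculus
    available for static functions. *)
Lemma C1_on_spacetime T f : C1_on (@punctured R n) f -> C1_spacetime T (fun=> f).
Proof.
move=> Cf; split.
- move=> t x [[/= t0 _] x0]; apply/cvg_ex; exists 0.
  rewrite (_ : dt_quotient _ _ _ = fun=> 0); first exact: cvg_cst.
  by apply/funext => h; rewrite /dt_quotient subrr mulr0.
- apply/within_stP => p Dp; rewrite dt_const; last by case: Dp => -[].
  have H : (fun _ : R * V => 0 : R) @ near_st T p --> (0 : R) by exact: cvg_cst.
  apply: cvg_trans H; apply: near_eq_cvg.
  by apply: filterS (near_st_in T p) => q [[q0 _] _]; rewrite dt_const.
- move=> i; have [d c] := Cf i; split; first by move=> t x [_ x0]; exact: d.
  apply/within_stP => p Dp; have /subspace_continuousP /(_ p.2) H := c.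
  have [_ p0] := Dp.
  apply: cvg_comp (H p0).
  move=> A; rewrite /within /= => hA.
  have h1 : \forall q \near near_st T p, q.2 != 0 -> A q.2 := @near_st_cvg2 _ _ T p _ hA.
  suff : \forall q \near near_st T p, A q.2 by [].
  by apply: filterS2 h1 (near_st_in T p) => q a b; apply: a; case: b.
Qed.

Lemma C1_spacetime_on T (F : R -> V -> R) t : C1_spacetime T F -> time_domain T t ->
  C1_on (@punctured R n) (F t).
Proof.
move=> CF tT i; have [_ _ /(_ i) [d c]] := CF; split.
  by move=> x x0; apply: d; split.
apply/subspace_continuousP => x x0.
have := (within_stP _ _).1 c (t, x) (conj tT x0) => /= H.
apply: (@cvg_comp _ _ _ (fun z => (t, z)) (fun q : R * V => 'D_(std_basis R i) (F q.1) q.2)) H.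
apply: cvg_near_st => //=.
- exact: cvg_cst.
- exact: cvg_within.
- by apply: nearW; case: tT.
Qed.

Lemma C2_on_spacetime T f : C2_on (@punctured R n) f -> C2_spacetime T (fun=> f).
Proof.
move=> [C1 C2]; split; first exact: C1_on_spacetime.
- apply: (@C1_eq _ _ _ (fun _ _ => 0)); last exact: C1_cst.
  by move=> q [[q0 _] _]; rewrite dt_const.
- by move=> i; apply: C1_on_spacetime; exact: C2.
Qed.

Lemma C2_spacetime_on T (F : R -> V -> R) t : C2_spacetime T F -> time_domain T t ->
  C2_on (@punctured R n) (F t).
Proof.
move=> [C1 _ C2] tT; split; first exact: C1_spacetime_on C1 tT.
by move=> i; exact: (C1_spacetime_on (C2 i) tT).
Qed.

Lemma gradE f x i : grad f x 0 i = 'D_(std_basis R i) f x.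
Proof. by rewrite mxE. Qed.

(* The Legendre transform of [f] at [grad f x]; minus the value at [0] of the
   tangent plane of [f] at [x]. *)
Definition intercept f x : R := dot x (grad f x) - f x.

(** The real-valued form of [S1] together with nonlinearity at infinity; the equivalence is
    [legendreP]. *)
Record legendre f : Prop := Legendre {
  leg0 : f 0 = 0;
  leg_gt0 : forall x, x != 0 -> 0 < f x;
  leg_conv : forall x z (s : R), 0 <= s -> s <= 1 ->
    f (s *: x + (1 - s) *: z) <= s * f x + (1 - s) * f z;
  leg_C1 : C1_on (@punctured R n) f;
  leg_strict : forall x z, x != z -> ~ (forall s : R, 0 <= s -> s <= 1 ->
    f (s *: x + (1 - s) *: z) = s * f x + (1 - s) * f z);
  leg_nl : forall x, x != 0 -> ~ exists a b : R, [/\ 0 <= a, 0 < b &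
    forall t : R, 0 <= t -> a * t - b <= f (t *: x) /\ f (t *: x) <= a * t] }.

Lemma C1_on_cvg f x : C1_on (@punctured R n) f -> x != 0 -> f z @[z --> x] --> f x.
Proof.
move=> fC1 x0.
have H := C1_cvg (C1_on_spacetime +oo fC1) (punctured_st x0 (lexx 0)).
apply: (@cvg_comp _ _ _ (fun z : V => (0 : R, z)) (fun q : R * V => f q.2)) H.
apply: (@cvg_near_st _ _ _ _ (nbhs x) (fun=> 0) id (0, x)).
- exact: punctured_st.
- exact: cvg_cst.
- exact: cvg_id.
- exact: nearW.
Qed.

Lemma legendreP u : (S1 u /\ nonlinear_at_infinity u) <->
  (u = EFin \o (fine \o u) /\ legendre (fine \o u)).
Proof.
split.
- move=> [[[u_ge0 u0 _ uconv] ufin uC1 uns] unl].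
  have uE x : u x = ((fine \o u) x)%:E.
    rewrite /= fineK // ge0_fin_numE //; exact: ufin.
  have f_ge0 x : 0 <= (fine \o u) x by rewrite -lee_fin -uE.
  move: (fine \o u) uE uC1 f_ge0 => f uE uC1 f_ge0.
  have f0 : f 0 = 0 by have := u0; rewrite uE => -[].
  have fconv x z s : 0 <= s -> s <= 1 ->
      f (s *: x + (1 - s) *: z) <= s * f x + (1 - s) * f z.
    by move=> s0 s1; have := uconv x z s s0 s1; rewrite !uE -!EFinM -EFinD lee_fin.
  have fstrict x z : x != z -> ~ (forall s : R, 0 <= s -> s <= 1 ->
      f (s *: x + (1 - s) *: z) = s * f x + (1 - s) * f z).
    move=> xz H; apply: uns; exists x, z; split => // s s0 s1.
    by rewrite !uE H // -!EFinM -EFinD.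
  split; first by apply/funext.
  split => //.
  (* If [f x = 0] then convexity makes [f] vanish on the whole segment from [0] to [x], against
     strict convexity. *)
  + move=> x x0; rewrite lt_neqAle f_ge0 andbT eq_sym; apply/negP => /eqP fx.
    apply: (fstrict _ _ x0) => s s0 s1; apply/eqP; rewrite eq_le fconv //=.
    by rewrite fx f0 !mulr0 addr0.
  + move=> x x0 [a [b [a0 b0 H]]]; have [_] := unl x x0; apply.
    by exists a, b; split => // t t0; have := H t t0; rewrite !uE !lee_fin.
- move=> [uE]; move: (fine \o u) uE => f -> [f0 fpos fconv fC1 fs fnl].
  have f_ge0 x : 0 <= f x.
    by have [->|x0] := eqVneq x 0; [rewrite f0|exact/ltW/fpos].
  split; [split|] => //=.
  + split => //=.
    * by rewrite f0.
    * move=> x a; rewrite lte_fin => ax.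
      (* At the origin lower semicontinuity follows from [f >= 0 = f 0], elsewhere from
         continuity. *)
      have [x0|x0] := eqVneq x 0.
        exists setT; first exact: filterT.
        move=> y _; rewrite lte_fin; apply: lt_le_trans (f_ge0 y).
        by move: ax; rewrite x0 f0.
      have H2 := C1_on_cvg fC1 x0.
      have {}ax : \forall z \near x, a < f z by move: ax => /(cvgr_gt _ H2).
      by exists [set z | a < f z] => // y; rewrite lte_fin.
  + by move=> x; exact: ltry.
  + move=> [x [z [xz H]]]; apply: (fs x z xz) => s s0 s1.
    by have := H s s0 s1; rewrite -!EFinM -EFinD => -[].
  + move=> x x0; split; first by move=> t _; exact: ltry.
    move=> [a [b [a0 b0 H]]]; apply: (fnl x x0); exists a, b; split => // t t0.
Qed.

Lemma C1_on_line f x (v : V) : C1_on (@punctured R n) f -> x != 0 ->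
  s^-1 * (f (x + s *: v) - f x) @[s --> (0 : R)^'] --> dot v (grad f x).
Proof.
move=> fC1 x0.
have := C1_cdiff (C1_on_spacetime +oo fC1) (punctured_st x0 (lexx 0)).
move=> [al [be [_ cb E]]].
have c : (0 : R, x + s *: v) @[s --> (0 : R)^'] --> near_st (+oo%E : \bar R) (0, x).
  apply: cvg_near_st; [exact: punctured_st|exact: cvg_cst| |exact: nearW].
  rewrite -[X in _ --> X]addr0; apply: cvgD; first exact: cvg_cst.
  rewrite -[X in _ --> X](scale0r v); apply: cvgZl.
  exact: cvg_within.
have H : \sum_(i < n) v 0 i * be i (0, x + s *: v) @[s --> (0 : R)^'] --> dot v (grad f x).
  apply: cvg_sumr => i _; apply: cvgM; first exact: cvg_cst.
  by rewrite mxE; exact: (cvg_comp _ _ c (cb i)).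
apply: cvg_trans H; apply: near_eq_cvg.
have E' := c _ E.
near=> s.
have s0 : s != 0 by near: s; exact: nbhs_dnbhs_neq.
have -> : f (x + s *: v) - f x = (0 - 0) * al (0, x + s *: v) +
   \sum_(i < n) ((x + s *: v) 0 i - x 0 i) * be i (0, x + s *: v).
  by near: s; exact: E'.
rewrite subrr mul0r add0r mulr_sumr; apply: eq_bigr => i _.
by rewrite !mxE addrAC subrr add0r !mulrA mulVf // mul1r.
Unshelve. all: by end_near. Qed.

(** Fermat's rule: when [phi] is the difference quotient at a minimum, [s * phi s] is the
    nonnegative increment. *)
Lemma cvg_sign (phi : R -> R) (l : R) : phi s @[s --> (0 : R)^'] --> l ->
  (forall s, s != 0 -> 0 <= s * phi s) -> l = 0.
Proof.
move=> H sphi; apply/eqP; rewrite eq_le; apply/andP; split.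
- rewrite leNgt; apply/negP => /(cvgr_gt _ H) /nbhs_ballP [e /= e0 h].
  have e2 : - (e / 2) < 0 by rewrite oppr_lt0 divr_gt0.
  have h1 : 0 < phi (- (e / 2)).
    apply: h; last by rewrite lt_eqF.
    by rewrite /ball /= sub0r opprK gtr0_norm ?divr_gt0 // ltr_pdivrMr // ltr_pMr // ltr1n.
  by have := sphi _ (ltr0_neq0 e2); rewrite leNgt pmulr_llt0 // e2.
- rewrite leNgt; apply/negP => /(cvgr_lt _ H) /nbhs_ballP [e /= e0 h].
  have e2 : 0 < e / 2 by rewrite divr_gt0.
  have h1 : phi (e / 2) < 0.
    apply: h; last by rewrite gt_eqF.
    by rewrite /ball /= sub0r normrN gtr0_norm ?divr_gt0 // ltr_pdivrMr // ltr_pMr // ltr1n.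
  by have := sphi _ (lt0r_neq0 e2); rewrite leNgt pmulr_rlt0 // h1.
Qed.

(** The tangent plane at [x] lies below [f]: otherwise the slope at [x] towards [z] exceeds
    [f z - f x], and a small step towards [z] violates convexity. *)
Lemma legendre_grad f x z : legendre f -> x != 0 -> dot z (grad f x) - intercept f x <= f z.
Proof.
move=> L x0.
have H := C1_on_line (v := z - x) (leg_C1 L) x0.
rewrite /intercept; have -> : dot z (grad f x) - (dot x (grad f x) - f x) =
  dot (z - x) (grad f x) + f x by rewrite dotBl; ring.
rewrite -lerBrDr leNgt; apply/negP => /(cvgr_gt _ H) /nbhs_ballP [e /= e0 h].
pose d := Num.min (e / 2) 1.
have d0 : 0 < d by rewrite lt_min divr_gt0 //= ltr01.
have d1 : d <= 1 by rewrite ge_min lexx orbT.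
have := h d; rewrite /ball /= sub0r normrN gtr0_norm // => /(_ _ (lt0r_neq0 d0)).
have -> : d < e.
  by apply: (@le_lt_trans _ _ (e / 2)); [rewrite ge_min lexx|rewrite ltr_pdivrMr // ltr_pMr // ltr1n].
move=> /(_ isT); rewrite mulrC ltr_pdivlMr // => H1.
have := leg_conv L z x (ltW d0) d1.
have -> : d *: z + (1 - d) *: x = x + d *: (z - x).
  by rewrite scalerBl scalerBr scale1r addrC addrA addrAC -addrA.
by move: H1; lra.
Qed.

(** A second contact point with the tangent plane would make [f] affine on the segment between the
    two. *)
Lemma legendre_grad_eq f x z : legendre f -> x != 0 ->
  f z = dot z (grad f x) - intercept f x -> z = x.
Proof.
move=> L x0 E; apply/eqP; apply/negPn/negP => zx; apply: (leg_strict L zx) => s s0 s1.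
apply/eqP; rewrite eq_le leg_conv //=.
have := legendre_grad (s *: z + (1 - s) *: x) L x0.
apply: le_trans; rewrite E dotDl !dotZl /intercept; lra.
Qed.

(** At the origin the tangent plane has the value [- intercept f x], which is at most [f 0 = 0];
    equality would be a second contact point. *)
Lemma intercept_gt0 f x : legendre f -> x != 0 -> 0 < intercept f x.
Proof.
move=> L x0; have := legendre_grad 0 L x0; rewrite dot0l (leg0 L) sub0r oppr_le0 => H.
rewrite lt_neqAle H andbT; apply/negP => /eqP E.
have := @legendre_grad_eq f x 0 L x0; rewrite dot0l (leg0 L) -E subr0 => /(_ erefl) /esym.
by apply/eqP.
Qed.

(** The tangent inequalities at [x] and at [r *: x], each tested at the other point, show that the
    slope along the ray increases and that the intercept grows by at least as much. *)
Lemma intercept_mono f x (r : R) : legendre f -> x != 0 -> 1 <= r ->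
  intercept f x <= intercept f (r *: x).
Proof.
move=> L x0; rewrite le_eqVlt => /predU1P[<-|r1]; first by rewrite scale1r.
have r0 : 0 < r by apply: lt_trans r1.
have rx : r *: x != 0 by rewrite scaler_eq0 negb_or gt_eqF.
have h1 := legendre_grad (r *: x) L x0; have h2 := legendre_grad x L rx.
move: h1 h2; rewrite /intercept !dotZl.
set a := dot x (grad f x); set b := dot x (grad f (r *: x)).
set F := f x; set G := f (r *: x) => h1 h2.
rewrite -subr_ge0 -(pmulr_rge0 _ (_ : 0 < r - 1)); last by rewrite subr_gt0.
nra.
Qed.

(** Nonlinearity at infinity enters here: if the intercepts stayed below [B], then [f] would lie
    between [a t - B] and [a t] on the ray, with [a] the supremum of the slopes. *)
Lemma intercept_unbounded f x (B : R) : legendre f -> x != 0 ->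
  exists2 s, 0 < s & B < intercept f (s *: x).
Proof.
move=> L x0; apply: contrapT => H.
have {}H s : 0 < s -> intercept f (s *: x) <= B.
  by move=> s0; rewrite leNgt; apply/negP => h; apply: H; exists s.
pose sl s := dot x (grad f (s *: x)).
have sx s : 0 < s -> s *: x != 0 by move=> s0; rewrite scaler_eq0 negb_or gt_eqF.
have h1 r s : 0 < s -> r * sl s - B <= f (r *: x).
  move=> s0; have := legendre_grad (r *: x) L (sx s s0); have := H s s0.
  rewrite dotZl -/(sl s); lra.
have h2 s : 0 < s -> f (s *: x) <= s * sl s.
  move=> s0; have := intercept_gt0 L (sx s s0); rewrite /intercept dotZl -/(sl s).
  by move=> h; apply: ltW; rewrite -subr_gt0.
(* The slopes are bounded by [f x + B]: test the tangent planes at [x] itself, that is [r = 1] in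
   [h1]. *)
pose S := [set sl s | s in [set s | 0 < s]].
have Sne : S !=set0 by exists (sl 1), 1 => //=.
have Sub : ubound S (f x + B).
  by move=> _ [s /= s0 <-]; have := h1 1 s s0; rewrite scale1r; lra.
have Ssup : has_sup S by split => //; exists (f x + B).
have sle s : 0 < s -> sl s <= sup S.
  by move=> s0; apply: sup_upper_bound => //; exists s.
have sup0 : 0 < sup S.
  apply: lt_le_trans (sle 1 ltr01); have := h2 1 ltr01; rewrite mul1r scale1r.
  by apply: lt_le_trans; exact: (leg_gt0 L).
have B0 : 0 < B by apply: lt_le_trans (H 1 ltr01); apply: intercept_gt0 => //; exact: sx.
apply: (leg_nl L x0); exists (sup S), B; split => //; first exact: ltW.
move=> t; rewrite le_eqVlt => /predU1P[<-|t0].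
  by rewrite scale0r (leg0 L) mulr0 sub0r oppr_le0 ltW.
split; last by apply: le_trans (h2 t t0) _; rewrite [X in _ <= X]mulrC ler_pM2l //; exact: sle.
rewrite lerBlDr mulrC -ler_pdivlMl //.
apply: ge_sup => // _ [s /= s0 <-].
by rewrite ler_pdivlMl // -lerBlDr; exact: h1.
Qed.

(** [x] maximizes the quotient [(<z, y> - 1) / f z]; cross-multiplication includes the point
    [z = 0], where [f] vanishes. *)
Definition polar_max f (y x : V) : Prop :=
  [/\ x != 0, 0 < dot x y - 1 & forall z, (dot z y - 1) * f x <= (dot x y - 1) * f z].

(** The gradient condition says that the tangent plane of [f] at [x] is
    [intercept f x * (<., y> - 1)]. Fermat's rule gives necessity; sufficiency is the tangent
    inequality divided by the intercept. *)
Lemma polar_maxP f y x : legendre f ->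
  polar_max f y x <-> (x != 0 /\ grad f x = intercept f x *: y).
Proof.
move=> L; split.
- move=> [x0 d0 H]; split => //.
  have E i : (dot x y - 1) * (grad f x) 0 i = y 0 i * f x.
    have c1 : s^-1 * (f (x + s *: std_basis R i) - f x) - y 0 i * f x / (dot x y - 1)
        @[s --> (0 : R)^'] --> dot (std_basis R i) (grad f x) - y 0 i * f x / (dot x y - 1).
      by apply: cvgB; [exact: C1_on_line (leg_C1 L) x0|exact: cvg_cst].
    suff /eqP : dot (std_basis R i) (grad f x) - y 0 i * f x / (dot x y - 1) = 0.
      by rewrite dot_std subr_eq0 => /eqP ->; rewrite mulrC divfK ?gt_eqF.
    apply: (cvg_sign c1).
    move=> s s0; rewrite mulrBr mulVKf // subr_ge0 mulrA ler_pdivrMr //.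
    have := H (x + s *: std_basis R i); rewrite dotDl dotZl dot_std; lra.
  (* Pairing the first-order condition [E] with [x] identifies the multiplier [f x / (dot x y - 1)]
     as the intercept. *)
  have c : (dot x y - 1) * intercept f x = f x.
    rewrite /intercept mulrBr; have -> : (dot x y - 1) * dot x (grad f x) = dot x y * f x.
      rewrite /dot mulr_sumr mulr_suml; apply: eq_bigr => i _.
      by rewrite mulrCA E mulrA.
    by rewrite mulrBl mul1r opprB addrC subrK.
  apply/rowP => i; rewrite [RHS]mxE; apply: (mulfI (lt0r_neq0 d0)).
  by rewrite E mulrA c mulrC.
- move=> [x0 E]; have c0 := intercept_gt0 L x0.
  have Ex z : dot z (grad f x) = intercept f x * dot z y by rewrite E dotZr.
  have F0 : f x = intercept f x * (dot x y - 1).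
    by rewrite mulrBr mulr1 -Ex /intercept; ring.
  have d0 : 0 < dot x y - 1.
    by have := leg_gt0 L x0; rewrite F0 pmulr_rgt0.
  split => // z; have := legendre_grad z L x0; rewrite Ex => h.
  rewrite {1}F0 mulrCA [X in _ <= X]mulrC mulrA.
  by rewrite ler_pM2r // mulrC mulrBl mul1r mulrC.
Qed.

Lemma polar_max_neq0 f y x : polar_max f y x -> y != 0.
Proof.
by move=> [_ + _]; apply: contraTneq => ->; rewrite dot0r sub0r oppr_gt0 ltr10.
Qed.

Lemma polar_max_intercept f y x : legendre f -> polar_max f y x ->
  f x = intercept f x * (dot x y - 1).
Proof.
move=> L /(polar_maxP y x L) [x0 E].
by rewrite mulrBr mulr1 -dotZr -E /intercept; ring.
Qed.

(** Equal quotients place [z] on the tangent plane at [x], which touches the graph only at [x]. *)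
Lemma polar_max_uniq f y x z : legendre f -> polar_max f y x -> polar_max f y z -> z = x.
Proof.
move=> L mx mz; have [x0 E] := (polar_maxP y x L).1 mx.
apply: (legendre_grad_eq L x0); rewrite E dotZr.
have fx := polar_max_intercept L mx; have fz := polar_max_intercept L mz.
have [_ dx Hx] := mx; have [z0 dz Hz] := mz.
have E2 : (dot z y - 1) * f x = (dot x y - 1) * f z.
  by apply/eqP; rewrite eq_le Hx Hz.
rewrite (_ : _ - _ = intercept f x * (dot z y - 1)); last by ring.
apply: (mulfI (lt0r_neq0 dx)).
by rewrite -E2 fx; ring.
Qed.

Lemma polar0 u : polar u 0 = 0%E.
Proof.
apply/eqP; rewrite eq_le; apply/andP; split.
- apply: ereal_inf_lbound; exists 0 => //; split => // x.
  by rewrite dot0r mul0e adde0 lee_fin.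
- by apply: le_ereal_inf_tmp => _ [c [c0 _] <-]; rewrite lee_fin.
Qed.

Lemma polar_val f y x : polar_max f y x -> 0 < f x ->
  polar (EFin \o f) y = ((dot x y - 1) / f x)%:E.
Proof.
move=> [x0 d0 H] fx; apply/eqP; rewrite eq_le; apply/andP; split.
- apply: ereal_inf_lbound; exists ((dot x y - 1) / f x) => //; split.
    by apply: divr_ge0; exact: ltW.
  move=> z; rewrite /= -EFinM -EFinD lee_fin -lerBlDl.
  by rewrite mulrAC ler_pdivlMr.
- apply: le_ereal_inf_tmp => _ [c [c0 Hc] <-]; rewrite lee_fin ler_pdivrMr //.
  by have := Hc x; rewrite /= -EFinM -EFinD lee_fin lerBlDl.
Qed.

End Static.

(** * Existence and continuity of the maximizers for a family depending on time *)

Section Family.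
Variables (R : realType) (n : nat) (T : \bar R).
Local Notation V := 'rV[R]_n.
Variable f : R -> V -> R.
Hypothesis Cf : C2_spacetime T f.
Hypothesis Lf : forall t, time_domain T t -> legendre (f t).
Implicit Types (t : R) (x y z : V) (p q : R * V).

Let C1f : C1_spacetime T f. Proof. by case: Cf. Qed.

Lemma C1_intercept : C1_spacetime T (fun t x => intercept (f t) x).
Proof.
have -> : (fun t x => intercept (f t) x) =
    (fun t x => \sum_(i < n) x 0 i * 'D_(std_basis R i) (f t) x + - f t x).
  apply/funext => t; apply/funext => x; congr (_ - _).
  by apply: eq_bigr => i _; rewrite gradE.
have [_ _ CD] := Cf.
apply: C1D; last exact: C1N.
by apply: C1_sum => i; apply: C1M; [exact: C1_coord|exact: CD].
Qed.

Lemma sphere_compact : compact [set x : V | `|x| = 1].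
Proof.
apply: bounded_closed_compact.
  by exists 1; split => // r r1 x /= ->; exact: ltW.
have -> : [set x : V | `|x| = 1] = (fun x : V => `|x|) @^-1` [set 1] by [].
by apply: closed_comp; [move=> x _; exact: norm_continuous|exact: closed_eq].
Qed.

(** In each direction of the unit sphere a large intercept persists for nearby directions and times,
    and by monotonicity further out on the rays; compactness of the sphere makes the radius
    uniform. *)
Lemma intercept_locally_unbounded t0 (B : R) : time_domain T t0 ->
  exists2 M, 0 < M & \forall t \near within (time_domain T) (nbhs t0),
    forall x, M <= `|x| -> B < intercept (f t) x.
Proof.
move=> Dt0.
pose Ft := within (time_domain T) (nbhs t0).
have loc x : `|x| = 1 -> exists2 s, 0 < s &
    \forall i \near filter_prod (nbhs x) Ft, B < intercept (f i.2) (s *: i.1).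
  move=> x1; have x0 : x != 0 by rewrite -normr_gt0 x1.
  have [s s0 Bs] := intercept_unbounded B (Lf Dt0) x0.
  have sx0 : s *: x != 0 by rewrite scaler_eq0 negb_or gt_eqF.
  have Dp : spacetime T (t0, s *: x) by split.
  have H := C1_cvg C1_intercept Dp.
  have {}H : \forall q \near near_st T (t0, s *: x), B < intercept (f q.1) q.2.
    by move: Bs => /(cvgr_gt _ H).
  exists s => //.
  have c : (i.2, s *: i.1) @[i --> filter_prod (nbhs x) Ft] --> near_st T (t0, s *: x).
    apply: cvg_near_st => //=.
    - apply: (@cvg_comp _ _ _ snd id _ Ft); first exact: cvg_snd.
      exact: cvg_within.
    - by apply: cvgZr; exact: cvg_fst.
    - exists (setT, time_domain T).
        by split; [exact: filterT|exact: withinT].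
      by move=> [a b] /= [_ []].
  exact: c _ H.
have NC := (compact_near_coveringP _).1 sphere_compact.
have [|[U W] [/= hU [W0 [_ hW]]] UW] := NC _ (filter_prod Ft (+oo : set_system R))
  (fun i x => B < intercept (f i.1) (i.2 *: x)) _.
- move=> x /= /[dup] x1 /loc [s s0 [[U W] /= [hU hW] UW]].
  exists (U `&` (fun z => z != 0), ((W `&` time_domain T) `*` [set M | s < M])).
    split => /=.
      apply: filterI => //; apply: punctured_near.
      by rewrite -normr_gt0 x1.
    exists (W `&` time_domain T, [set M | s < M]) => //; split => /=.
      by apply: filterI => //; exact: withinT.
    by exists s; split => //; exact: num_real.
  move=> [x' [t M]] /= [[Ux' x'0] [[Wt Dt] sM]].
  apply: lt_le_trans (UW (x', t) (conj Ux' Wt)) _ => /=.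
  have -> : M *: x' = (M / s) *: (s *: x') by rewrite scalerA divfK // gt_eqF.
  apply: intercept_mono; first exact: Lf.
    by rewrite scaler_eq0 negb_or gt_eqF.
  by rewrite ler_pdivlMr // mul1r ltW.
- exists (`|W0| + 1); first by rewrite ltr_wpDl.
  have hU' : \forall t \near Ft, time_domain T t by exact: withinT.
  apply: filterS2 hU hU' => t Ut Dt x Mx.
  have x0 : 0 < `|x| by apply: lt_le_trans Mx; rewrite ltr_wpDl.
  have := UW (t, `|x|) _ (`|x|^-1 *: x).
  rewrite /= scalerA divff ?gt_eqF // scale1r; apply.
    split => //=; apply: hW.
    by apply: (@le_lt_trans _ _ `|W0|); [exact: ler_norm|apply: lt_le_trans Mx; rewrite ltrDl].
  by rewrite normrZ normfV normr_id mulVf // gt_eqF.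
Qed.

(* The quotient [(<x, y> - 1) / f x] is maximized over a ball outside of which
   the intercept exceeds [c0^-1]; there the ratio of [f - (<., y> - 1) / c] to
   the norm increases along rays, so that the maximum is global. *)
Lemma polar_max_exists t y : time_domain T t -> y != 0 -> exists x, polar_max (f t) y x.
Proof.
move=> Dt y0; have L := Lf Dt; have dyy := dot_gt0 y0.
(* A test point with [<x1, y> = 2]: the quotient there equals [c0], a positive lower bound for the
   maximum. *)
pose x1 := (2 / dot y y) *: y.
have dx1 : dot x1 y = 2 by rewrite dotZl divfK // gt_eqF.
have x10 : x1 != 0 by rewrite scaler_eq0 negb_or y0 andbT gt_eqF // divr_gt0.
pose c0 := (f t x1)^-1; have c00 : 0 < c0 by rewrite invr_gt0; exact: leg_gt0.
have [M0 M00 HM0] := intercept_locally_unbounded c0^-1 Dt.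
have {}HM0 x : M0 <= `|x| -> c0^-1 < intercept (f t) x.
  move: x; apply: (@nbhs_singleton _ t (fun s => time_domain T s -> forall x, M0 <= `|x| -> c0^-1 < intercept (f s) x)) => //.
pose M := Num.max M0 `|x1|.
have M_gt0 : 0 < M by rewrite lt_max M00.
have HM x : M <= `|x| -> c0^-1 < intercept (f t) x.
  by move=> Mx; apply: HM0; apply: le_trans Mx; rewrite le_max lexx.
have dcont z : dot w y @[w --> z] --> dot z y.
  by apply: (@cvg_dot _ _ _ (nbhs z)) => i; [exact: coord_continuous|exact: cvg_cst].
(* The condition [1 <= dot z y] keeps the origin out of [K], where the quotient would not be
   continuous; below 1 the numerator is negative anyway. *)
pose K := [set z : V | `|z| <= M] `&` [set z | 1 <= dot z y].
have Kc : compact K.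
  apply: bounded_closed_compact.
    by exists M; split; [exact: num_real|move=> r r1 x [/= Mx _]]; rewrite ltW // (le_lt_trans Mx).
  apply: closedI.
    apply: (@closed_comp _ _ (fun x : V => `|x|) [set r | r <= M]); last exact: closed_le.
    by move=> x _; exact: norm_continuous.
  apply: (@closed_comp _ _ (fun x : V => dot x y) [set r | 1 <= r]); last exact: closed_ge.
  by move=> x _; exact: dcont.
have Kx1 : K x1 by split; [rewrite /= le_max lexx orbT|rewrite /= dx1 ler1n].
have K0 z : K z -> z != 0.
  by move=> [_ /=]; apply: contraTneq => ->; rewrite dot0l -ltNge ltr01.
have [|x Kx Hx] := @EVT_max_rV _ _ (fun z => (dot z y - 1) / f t z) K (ex_intro _ _ Kx1) Kc.
  have H (z : V) (FI : set_system V) : Filter FI -> FI --> z -> K z ->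
      (dot w y - 1) / f t w @[w --> FI] --> (dot z y - 1) / f t z.
    move=> FF FIz Kz; apply: cvgM.
      apply: cvgB; last exact: cvg_cst.
      exact: (cvg_comp _ _ FIz (dcont z)).
    apply: cvgV; first by rewrite gt_eqF // leg_gt0 // K0.
    exact: (cvg_comp _ _ FIz (C1_on_cvg (leg_C1 L) (K0 z Kz))).
  apply/subspace_continuousP => z Kz.
  by apply: H => //; exact: cvg_within.
have {}Kx : K x by rewrite inE in Kx.
have {}Hx z : K z -> (dot z y - 1) / f t z <= (dot x y - 1) / f t x by move=> Kz; apply: Hx; rewrite inE.
have x0 := K0 _ Kx; have fx := leg_gt0 L x0.
pose c := (dot x y - 1) / f t x.
have cc0 : c0 <= c by have := Hx _ Kx1; rewrite dx1 (_ : 2 - 1 = 1) ?mul1r //; ring.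
have c_gt0 : 0 < c by apply: lt_le_trans cc0.
have key z : dot z y - 1 <= c * f t z.
  have f_ge0 w : 0 <= f t w.
    by have [->|w0] := eqVneq w 0; [rewrite (leg0 L)|exact/ltW/leg_gt0].
  have small w : `|w| <= M -> dot w y - 1 <= c * f t w.
    move=> wM; have [w1|w1] := leP 1 (dot w y).
      have Kw : K w by split.
      by rewrite -ler_pdivrMr; [exact: Hx|exact: leg_gt0 (K0 _ Kw)].
    apply: (@le_trans _ _ 0); first by rewrite subr_le0 ltW.
    by apply: mulr_ge0 => //; exact: ltW.
  have [zM|zM] := leP `|z| M; first exact: small.
  pose r := `|z| / M; have r1 : 1 < r by rewrite ltr_pdivlMr // mul1r.
  have r0 : 0 < r by apply: lt_trans r1.
  pose w := r^-1 *: z.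
  have zE : z = r *: w by rewrite scalerA divff ?scale1r // gt_eqF.
  have wM : `|w| = M.
    rewrite normrZ gtr0_norm ?invr_gt0 // /r invf_div divfK // gt_eqF //.
    exact: lt_trans zM.
  have w0 : w != 0 by rewrite -normr_gt0 wM.
  have h1 := legendre_grad z L w0.
  have h2 := small w; rewrite wM lexx in h2; have {}h2 := h2 isT.
  have h3 := HM w; rewrite wM lexx in h3; have {}h3 := h3 isT.
  have h4 : 1 < c * intercept (f t) w.
    rewrite -ltr_pdivrMl // mulr1; apply: le_lt_trans h3.
    by rewrite lef_pV2.
  have {}h1 : r * f t w + (r - 1) * intercept (f t) w <= f t z.
    apply: le_trans h1; rewrite zE dotZl /intercept; lra.
  apply: le_trans (_ : c * (r * f t w + (r - 1) * intercept (f t) w) <= _); last by rewrite ler_pM2l.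
  rewrite zE dotZl; nra.
exists x; split => //; first by move: c_gt0; rewrite /c pmulr_lgt0 // invr_gt0.
by move=> z; have := key z; rewrite /c mulrAC ler_pdivlMr.
Qed.

Definition polar_point t y : V := xget 0 [set x | polar_max (f t) y x].

(** No maximizer exists for [y = 0]; the value 0 there is that of [polar], by [polar0]. *)
Definition polar_fun t y : R :=
  if y == 0 then 0 else (dot (polar_point t y) y - 1) / f t (polar_point t y).

Lemma polar_pointP t y : time_domain T t -> y != 0 -> polar_max (f t) y (polar_point t y).
Proof.
by move=> Dt y0; have [x mx] := polar_max_exists Dt y0; exact: (xgetPex 0 (ex_intro _ _ mx)).
Qed.

Lemma polar_point_unique t y x : time_domain T t -> polar_max (f t) y x -> polar_point t y = x.
Proof.
move=> Dt mx; apply: (polar_max_uniq (Lf Dt) mx).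
by apply: polar_pointP => //; exact: polar_max_neq0 mx.
Qed.

Lemma polar_funP t y : time_domain T t -> polar (EFin \o f t) y = (polar_fun t y)%:E.
Proof.
move=> Dt; rewrite /polar_fun; have [->|y0] := eqVneq y 0; first exact: polar0.
apply: polar_val; first exact: polar_pointP.
by apply: leg_gt0; [exact: Lf|case: (polar_pointP Dt y0)].
Qed.

(** Near [p] the maximizers lie in a compact annulus [r <= |z| <= M]. On its part at distance at
    least [e] from [x], uniqueness makes the maximality inequality at [p] strict, and by compactness
    it stays strict for all nearby [q], which excludes the maximizer of [q] from that part. *)
Lemma polar_point_cvg p : spacetime T p ->
  polar_point q.1 q.2 @[q --> near_st T p] --> polar_point p.1 p.2.
Proof.
move=> Dp; have [Dt y0] := Dp.
have mx := polar_pointP Dt y0; have [x0 d0 Hx] := mx.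
set x := polar_point p.1 p.2 in mx x0 d0 Hx *.
have L := Lf Dt; have fx := leg_gt0 L x0.
have Dx : spacetime T (p.1, x) by [].
(* The intercept at the maximizer of [q] is at most [f q.1 x / (dot x q.2 - 1)], which stays below
   twice its value at [p]; beyond the radius [M] intercepts exceed this bound. *)
pose B := 2 * f p.1 x / (dot x p.2 - 1).
have [M M0 HM] := intercept_locally_unbounded B Dt.
have cfx : f q.1 x @[q --> near_st T p] --> f p.1 x.
  have c : (q.1, x) @[q --> near_st T p] --> near_st T (p.1, x).
    apply: cvg_near_st => //=; [exact: near_st_cvg1|exact: cvg_cst|].
    by apply: filterS (near_st_in T p) => q [[]].
  exact: (cvg_comp _ _ c (C1_cvg C1f Dx)).
have cdx : dot x q.2 @[q --> near_st T p] --> dot x p.2.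
  by apply: cvg_dot => i; [exact: cvg_cst|exact: near_st_coord].
apply/cvgrPdist_lt => e e0.
(* A maximizer satisfies [1 < <z, q.2> <= n |z| |q.2|], and [|q.2| < |p.2| + 1]. The last [+ 1]
   makes [r] positive and the bound strict. *)
pose r := (n%:R * (`|p.2| + 1) + 1)^-1.
have r0 : 0 < r by rewrite invr_gt0 ltr_wpDl // mulr_ge0.
pose K := [set z : V | r <= `|z|] `&` [set z | `|z| <= M] `&` [set z | e <= `|x - z|].
have Kc : compact K.
  apply: bounded_closed_compact.
    by exists M; split; [exact: num_real|move=> s s1 z [[_ /= Mz] _]]; rewrite ltW // (le_lt_trans Mz).
  apply: closedI; first apply: closedI.
  - apply: (@closed_comp _ _ (fun x : V => `|x|) [set s | r <= s]); last exact: closed_ge.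
    by move=> z _; exact: norm_continuous.
  - apply: (@closed_comp _ _ (fun x : V => `|x|) [set r | r <= M]); last exact: closed_le.
    by move=> z _; exact: norm_continuous.
  - apply: (@closed_comp _ _ (fun z : V => `|x - z|) [set s | e <= s]); last exact: closed_ge.
    have nc (z : V) (FI : set_system V) : Filter FI -> FI --> z -> `|x - w| @[w --> FI] --> `|x - z|.
      by move=> FF FIz; apply: cvg_norm; apply: cvgB; [exact: cvg_cst|exact: FIz].
    by move=> z _; apply: (nc z (nbhs z)); exact: cvg_id.
have NC := (compact_near_coveringP _).1 Kc.
have claim (z : V) (FI : set_system V) : Filter FI -> FI --> z -> K z ->
    \forall i \near filter_prod FI (near_st T p),
      (dot i.1 i.2.2 - 1) * f i.2.1 x < (dot x i.2.2 - 1) * f i.2.1 i.1.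
  move=> FF FIz [[/= rz _] ez].
  have z0 : z != 0 by rewrite -normr_gt0; apply: lt_le_trans rz.
  have Dz : spacetime T (p.1, z) by [].
  have zx : z != x.
    by apply: contraTneq ez => ->; rewrite subrr normr0 -ltNge.
  (* Equality would make [z] a second maximizer for [p]. *)
  have lt_z : 0 < (dot x p.2 - 1) * f p.1 z - (dot z p.2 - 1) * f p.1 x.
    rewrite subr_gt0 lt_neqAle Hx andbT; apply: contra zx => /eqP E.
    apply/eqP; apply: (polar_max_uniq L mx).
    have fz := leg_gt0 L z0.
    have dz : 0 < dot z p.2 - 1.
      by rewrite -(pmulr_lgt0 _ fx) E mulr_gt0.
    split => // w; rewrite -(ler_pM2r fx).
    have -> : (dot z p.2 - 1) * f p.1 w * f p.1 x = (dot x p.2 - 1) * f p.1 w * f p.1 z.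
      by rewrite mulrAC E mulrAC.
    by rewrite mulrAC ler_pM2r.
  have c : (dot x i.2.2 - 1) * f i.2.1 i.1 - (dot i.1 i.2.2 - 1) * f i.2.1 x
      @[i --> filter_prod (FI) (near_st T p)] -->
      (dot x p.2 - 1) * f p.1 z - (dot z p.2 - 1) * f p.1 x.
    have c2 : i.2 @[i --> filter_prod (FI) (near_st T p)] --> near_st T p by exact: cvg_snd.
    have c1 : i.1 @[i --> filter_prod (FI) (near_st T p)] --> z by exact: (cvg_comp _ _ (@cvg_fst _ _ _ _ _) FIz).
    have cz : (i.2.1, i.1) @[i --> filter_prod (FI) (near_st T p)] --> near_st T (p.1, z).
      apply: cvg_near_st => //=.
        exact: (cvg_comp _ _ c2 (@near_st_cvg1 _ _ _ _)).
      have h : \forall i \near filter_prod FI (near_st T p), spacetime T i.2 := c2 _ (near_st_in T p).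
      by apply: filterS h => i [[]].
    apply: cvgB; apply: cvgM.
    - by apply: cvgB; [exact: (cvg_comp _ _ c2 cdx)|exact: cvg_cst].
    - exact: (cvg_comp _ _ cz (C1_cvg C1f Dz)).
    - apply: cvgB; last exact: cvg_cst.
      apply: cvg_dot => i.
        exact: (cvg_comp _ _ c1 (@coord_continuous _ _ _ 0 i z)).
      exact: (cvg_comp _ _ c2 (@near_st_coord _ _ _ _ i)).
    - exact: (cvg_comp _ _ c2 cfx).
  by move: lt_z => /(cvgr_gt _ c); apply: filterS => i; rewrite subr_gt0.
have H1 : \forall q \near near_st T p, K `<=` (fun z => (dot z q.2 - 1) * f q.1 x < (dot x q.2 - 1) * f q.1 z).
  apply: (NC _ (near_st T p) (fun q z => (dot z q.2 - 1) * f q.1 x < (dot x q.2 - 1) * f q.1 z)) => z Kz.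
  exact: (claim z (nbhs z) _ (@cvg_id _ _) Kz).
have H2 : \forall q \near near_st T p, 0 < dot x q.2 - 1.
  by apply: (cvgr_gt (dot x p.2 - 1)) => //; apply: cvgB => //; exact: cvg_cst.
have H3 : \forall q \near near_st T p, f q.1 x / (dot x q.2 - 1) < B.
  apply: (cvgr_lt (f p.1 x / (dot x p.2 - 1))).
    apply: cvgM => //; apply: cvgV; first by rewrite gt_eqF.
    by apply: cvgB => //; exact: cvg_cst.
  by rewrite /B -mulrA mulr_natl mulr2n ltrDl divr_gt0.
have H4 : \forall q \near near_st T p, `|q.2| < `|p.2| + 1.
  apply: (cvgr_lt `|p.2|); last by rewrite ltrDl.
  by apply: cvg_norm; exact: near_st_cvg2.
have H5 : \forall q \near near_st T p, forall x, M <= `|x| -> B < intercept (f q.1) x.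
  have : (q.1 @[q --> near_st T p]) `=>` within (time_domain T) (nbhs p.1).
    move=> A hA; have h1 : \forall q \near near_st T p, time_domain T q.1 -> A q.1 := @near_st_cvg1 _ _ T p _ hA.
    suff : \forall q \near near_st T p, A q.1 by [].
    by apply: filterS2 h1 (near_st_in T p) => q a b; apply: a; case: b.
  by move=> /(_ _ HM).
near=> q.
have Dq : spacetime T q by near: q; exact: near_st_in.
have mq := polar_pointP Dq.1 Dq.2; set z := polar_point q.1 q.2 in mq *.
have [z0 dz Hz] := mq.
rewrite ltNge; apply/negP => ez.
have : K z.
  split => //; split => /=.
  - have := dot_le z q.2; rewrite leNgt => /negP h; rewrite leNgt; apply/negP => zr; apply: h.
    have h4 : `|q.2| < `|p.2| + 1 by near: q; exact: H4.
    have h5 : n%:R * (`|z| * `|q.2|) <= n%:R * (r * (`|p.2| + 1)).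
      by apply: ler_wpM2l => //; apply: ler_pM => //; exact: ltW.
    have h6 : n%:R * (r * (`|p.2| + 1)) < 1.
      by rewrite mulrCA /r mulrC ltr_pdivrMr ?mul1r ?ltrDl // ltr_wpDl // mulr_ge0.
    apply: le_lt_trans h5 _; apply: lt_trans h6 _.
    by apply: lt_le_trans (ler_norm _); rewrite -subr_gt0.
  - rewrite leNgt; apply/negP => Mz.
    have : B < intercept (f q.1) z.
      by have : forall x, M <= `|x| -> B < intercept (f q.1) x; [near: q; exact: H5|apply; exact: ltW].
    have dx : 0 < dot x q.2 - 1 by near: q; exact: H2.
    have Bx : f q.1 x / (dot x q.2 - 1) < B by near: q; exact: H3.
    apply/negP; rewrite -leNgt; apply: le_trans (ltW Bx).
    have := Hz x; rewrite (polar_max_intercept (Lf Dq.1) mq) mulrA [X in _ <= X]mulrC ler_pM2r //.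
    by rewrite ler_pdivlMr // mulrC.
have h1 : K `<=` (fun z => (dot z q.2 - 1) * f q.1 x < (dot x q.2 - 1) * f q.1 z) by near: q; exact: H1.
by move=> /h1; rewrite ltNge Hz.
Unshelve. all: by end_near. Qed.

End Family.

(** * Regularity of the polar maximizer *)

Section MatrixLimits.
Variables (R : realType) (I : Type) (FI : set_system I).
Context {FF : Filter FI}.

Lemma cvg_bigsum (J : Type) (r : seq J) (P : pred J) (f : J -> I -> R) (l : J -> R) :
  (forall k, f k x @[x --> FI] --> l k) ->
  \sum_(k <- r | P k) f k x @[x --> FI] --> \sum_(k <- r | P k) l k.
Proof.
move=> h; elim: r => [|k r IH].
  rewrite big_nil (_ : (fun x => _) = (fun=> 0)); first exact: cvg_cst.
  by apply/funext => x; rewrite big_nil.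
rewrite (_ : (fun x => _) = (fun x => (if P k then f k x else 0) + \sum_(k <- r | P k) f k x)).
  rewrite big_cons; case: (P k); first exact: cvgD.
  rewrite (_ : (fun x => _) = (fun x => \sum_(k <- r | P k) f k x)) //.
  by apply/funext => x; rewrite add0r.
by apply/funext => x; rewrite big_cons; case: (P k); rewrite ?add0r.
Qed.

Lemma cvg_bigprod (J : Type) (r : seq J) (P : pred J) (f : J -> I -> R) (l : J -> R) :
  (forall k, f k x @[x --> FI] --> l k) ->
  \prod_(k <- r | P k) f k x @[x --> FI] --> \prod_(k <- r | P k) l k.
Proof.
move=> h; elim: r => [|k r IH].
  rewrite big_nil (_ : (fun x => _) = (fun=> 1)); first exact: cvg_cst.
  by apply/funext => x; rewrite big_nil.
rewrite (_ : (fun x => _) = (fun x => (if P k then f k x else 1) * \prod_(k <- r | P k) f k x)).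
  rewrite big_cons; case: (P k); first exact: cvgM.
  rewrite (_ : (fun x => _) = (fun x => \prod_(k <- r | P k) f k x)) //.
  by apply/funext => x; rewrite mul1r.
by apply/funext => x; rewrite big_cons; case: (P k); rewrite ?mul1r.
Qed.

Lemma cvg_det (m : nat) (M : I -> 'M[R]_m) (M0 : 'M[R]_m) :
  (forall i j, M x i j @[x --> FI] --> M0 i j) -> \det (M x) @[x --> FI] --> \det M0.
Proof.
move=> h; apply: cvg_bigsum => s; apply: cvgM; first exact: cvg_cst.
by apply: cvg_bigprod => i; exact: h.
Qed.

Lemma near_unitmx (m : nat) (M : I -> 'M[R]_m) (M0 : 'M[R]_m) :
  (forall i j, M x i j @[x --> FI] --> M0 i j) -> M0 \in unitmx ->
  \forall x \near FI, M x \in unitmx.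
Proof.
rewrite unitmxE unitfE => h /(cvgr_neq0 _ (cvg_det h)).
by apply: filterS => x; rewrite unitmxE unitfE.
Qed.

Lemma cvg_invmx (m : nat) (M : I -> 'M[R]_m) (M0 : 'M[R]_m) :
  (forall i j, M x i j @[x --> FI] --> M0 i j) -> M0 \in unitmx ->
  forall i j, invmx (M x) i j @[x --> FI] --> invmx M0 i j.
Proof.
move=> h u i j.
have e (A : 'M[R]_m) : A \in unitmx -> invmx A i j = (\det A)^-1 * cofactor A j i.
  by move=> uA; rewrite /invmx uA !mxE.
rewrite e //.
have H : (\det (M x))^-1 * cofactor (M x) j i @[x --> FI] --> (\det M0)^-1 * cofactor M0 j i.
  apply: cvgM.
    by apply: cvgV; [rewrite -unitfE -unitmxE|exact: cvg_det].
  apply: cvgM; first exact: cvg_cst.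
  apply: cvg_det => k l; rewrite !mxE (_ : (fun x => _) = (fun x => M x (lift j k) (lift i l))) //.
  by apply/funext => x; rewrite !mxE.
(* The cofactor formula describes [invmx] only at invertible matrices, hence only eventually along
   the filter. *)
apply: cvg_trans H; apply: near_eq_cvg.
by apply: filterS (near_unitmx h u) => x ux; rewrite e.
Qed.

End MatrixLimits.

(** * Implicit differentiation of the maximizer *)

Section Regularity.
Variables (R : realType) (n : nat) (T : \bar R).
Local Notation V := 'rV[R]_n.
Variable f : R -> V -> R.
Hypothesis Cf : C2_spacetime T f.
Hypothesis Lf : forall t, time_domain T t -> legendre (f t).
Hypothesis Hf : forall t x, time_domain T t -> x != 0 -> pos_def (hessian (f t) x).
Implicit Types (t : R) (x y z : V) (p q : R * V).

Let C1f : C1_spacetime T f. Proof. by case: Cf. Qed.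
Let C1Df i : C1_spacetime T (fun t => 'D_(std_basis R i) (f t)).
Proof. by case: Cf => _ _; exact. Qed.

Local Notation X := (polar_point f).
Local Notation D i g := ('D_(std_basis R i) g).

(** The first derivatives of [f] cancel, which leaves the Hessian paired with [x]. *)
Lemma D_intercept j t x : spacetime T (t, x) ->
  D j (intercept (f t)) x = \sum_i x 0 i * D j (D i (f t)) x.
Proof.
move=> Dp.
have H := cdiffD (cdiff_sum (fun i => cdiffM (cdiff_coord T i (t, x)) (C1_cdiff (C1Df i) Dp)))
  (cdiffM (cdiff_cst T (-1) (t, x)) (C1_cdiff C1f Dp)).
have {}H := cdiff_eq (G := fun t x => intercept (f t) x) Dp _ H.
rewrite (cdiff_D j Dp (H _)).2 /=; last first.
  move=> q _; rewrite mulN1r; congr (_ - _).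
  by apply: eq_bigr => i _; rewrite gradE.
rewrite mul0r add0r mulN1r big_split /= (bigD1 j) //= eqxx mul1r big1 ?addr0; last first.
  by move=> i /negbTE ij; rewrite eq_sym ij mul0r.
by rewrite addrAC subrr add0r.
Qed.

Lemma polar_point_st p : spacetime T p -> spacetime T (p.1, X p.1 p.2).
Proof. by move=> [Dt y0]; split => //; have [] := polar_pointP Cf Lf Dt y0. Qed.

Lemma polar_point_cvg_st p : spacetime T p ->
  (q.1, X q.1 q.2) @[q --> near_st T p] --> near_st T (p.1, X p.1 p.2).
Proof.
move=> Dp; apply: cvg_near_st => //=.
- exact: polar_point_st.
- exact: near_st_cvg1.
- exact: (polar_point_cvg Cf Lf Dp).
- by apply: filterS (near_st_in T p) => q [[]].
Qed.

(* Transposed spatial Jacobian at [x = X t y] of [grad f - (intercept f) y],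
   the map whose zero set defines [X]. *)
Definition polar_jac p : 'M[R]_n := \matrix_(j, i)
  (D j (D i (f p.1)) (X p.1 p.2) - D j (intercept (f p.1)) (X p.1 p.2) * p.2 0 i).

(** A vector [z] in the kernel satisfies [Hess f z = s y], with [s] the derivative of the intercept
    along [z]. Pairing with [x] gives [s = s <x, y>], and [<x, y> > 1] forces [s = 0]; positive
    definiteness then gives [z = 0]. *)
Lemma polar_jac_unit p : spacetime T p -> polar_jac p \in unitmx.
Proof.
move=> Dp; rewrite -row_free_unit; apply/inj_row_free => z zM.
have [Dt y0] := Dp; have DX := polar_point_st Dp.
have [x0 d0 _] := polar_pointP Cf Lf Dt y0.
set x := X p.1 p.2 in x0 d0 DX.
pose Hz i := \sum_j z 0 j * D j (D i (f p.1)) x.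
pose s := \sum_j z 0 j * D j (intercept (f p.1)) x.
have E i : Hz i = s * p.2 0 i.
  have /matrixP /(_ 0 i) := zM; rewrite !mxE.
  under eq_bigr do rewrite mxE mulrBr mulrA.
  by rewrite sumrB -mulr_suml => /eqP; rewrite subr_eq0 => /eqP.
have sE : s = s * dot x p.2.
  rewrite {1}/s; under eq_bigr do rewrite (D_intercept _ DX) mulr_sumr.
  rewrite exchange_big /= /dot mulr_sumr; apply: eq_bigr => i _.
  rewrite mulrCA -E /Hz mulr_sumr; apply: eq_bigr => j _; rewrite mulrCA //.
have s0 : s = 0.
  have : s * (dot x p.2 - 1) = 0 by rewrite mulrBr mulr1 -sE subrr.
  by move=> /eqP; rewrite mulf_eq0 (gt_eqF d0) orbF => /eqP.
have HzE i : \sum_j z 0 j * (hessian (f p.1) x)^T j i = Hz i.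
  by apply: eq_bigr => j _; rewrite !mxE.
apply/eqP/negPn/negP => /(Hf Dt x0); rewrite /quad_form /dot big1 ?ltxx // => i _.
by rewrite mxE HzE E s0 mul0r mulr0.
Qed.

(** Subtracting the equations [grad f = intercept * y] at [q] and at [p], written with Caratheodory
    slopes, gives an exact linear system for [X q - X p]. Its matrix tends to the invertible
    [polar_jac p], so solving it produces convergent slopes for [X]. *)
Lemma polar_point_cdiff p j : spacetime T p ->
  cdiff T (fun t y => X t y 0 j) p
    (\sum_i (dt (fun t x => intercept (f t) x) p.1 (X p.1 p.2) * p.2 0 i
             - dt (fun t => D i (f t)) p.1 (X p.1 p.2)) * invmx (polar_jac p) i j)
    (fun i => intercept (f p.1) (X p.1 p.2) * invmx (polar_jac p) i j).
Proof.
move=> Dp; have DX := polar_point_st Dp; have c := polar_point_cvg_st Dp.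
have [ga [ka [cga cka Ec]]] := C1_cdiff (C1_intercept Cf) DX.
have /(_ _)/cid hD := fun i => C1_cdiff (C1Df i) DX.
pose al i := projT1 (hD i).
have /(_ _)/cid hD2 := fun i => projT2 (hD i).
pose be i := projT1 (hD2 i).
have hh i : [/\ al i q @[q --> near_st T (p.1, X p.1 p.2)] --> dt (fun t => D i (f t)) p.1 (X p.1 p.2),
      forall k, be i k q @[q --> near_st T (p.1, X p.1 p.2)] --> D k (D i (f p.1)) (X p.1 p.2)
    & \forall q \near near_st T (p.1, X p.1 p.2), D i (f q.1) q.2 - D i (f p.1) (X p.1 p.2) =
        (q.1 - p.1) * al i q + \sum_(k < n) (q.2 0 k - X p.1 p.2 0 k) * be i k q].
  exact: (projT2 (hD2 i)).
pose M q : 'M[R]_n := \matrix_(k, i) (be i k (q.1, X q.1 q.2) - ka k (q.1, X q.1 q.2) * p.2 0 i).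
have cM k i : M q k i @[q --> near_st T p] --> polar_jac p k i.
  rewrite mxE (_ : (fun q => _) = (fun q => be i k (q.1, X q.1 q.2) - ka k (q.1, X q.1 q.2) * p.2 0 i)).
    apply: cvgB; first by have [_ /(_ k) h _] := hh i; exact: (cvg_comp _ _ c h).
    apply: cvgM; last exact: cvg_cst.
    exact: (cvg_comp _ _ c (cka k)).
  by apply/funext => q; rewrite mxE.
have cI := cvg_invmx cM (polar_jac_unit Dp).
exists (fun q => \sum_i (ga (q.1, X q.1 q.2) * p.2 0 i - al i (q.1, X q.1 q.2)) * invmx (M q) i j),
  (fun i q => intercept (f q.1) (X q.1 q.2) * invmx (M q) i j); split.
- apply: cvg_sumr => i _; apply: cvgM; last exact: cI.
  apply: cvgB.
    by apply: cvgM; [exact: (cvg_comp _ _ c cga)|exact: cvg_cst].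
  by have [h _ _] := hh i; exact: (cvg_comp _ _ c h).
- move=> i; apply: cvgM; last exact: cI.
  exact: (cvg_comp _ _ c (C1_cvg (C1_intercept Cf) DX)).
have E1 : \forall q \near near_st T p, forall i, D i (f q.1) (X q.1 q.2) - D i (f p.1) (X p.1 p.2) =
        (q.1 - p.1) * al i (q.1, X q.1 q.2) + \sum_(k < n) (X q.1 q.2 0 k - X p.1 p.2 0 k) * be i k (q.1, X q.1 q.2).
  by apply: filter_forall => i; have [_ _ h] := hh i; exact: c _ h.
have E2 : \forall q \near near_st T p, intercept (f q.1) (X q.1 q.2) - intercept (f p.1) (X p.1 p.2) =
        (q.1 - p.1) * ga (q.1, X q.1 q.2) + \sum_(k < n) (X q.1 q.2 0 k - X p.1 p.2 0 k) * ka k (q.1, X q.1 q.2).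
  exact: c _ Ec.
have uM := near_unitmx cM (polar_jac_unit Dp).
near=> q.
have Dq : spacetime T q by near: q; exact: near_st_in.
have F1 : forall i, D i (f q.1) (X q.1 q.2) - D i (f p.1) (X p.1 p.2) =
        (q.1 - p.1) * al i (q.1, X q.1 q.2) + \sum_(k < n) (X q.1 q.2 0 k - X p.1 p.2 0 k) * be i k (q.1, X q.1 q.2).
  by near: q; exact: E1.
have F2 : intercept (f q.1) (X q.1 q.2) - intercept (f p.1) (X p.1 p.2) =
        (q.1 - p.1) * ga (q.1, X q.1 q.2) + \sum_(k < n) (X q.1 q.2 0 k - X p.1 p.2 0 k) * ka k (q.1, X q.1 q.2).
  by near: q; exact: E2.
have uq : M q \in unitmx by near: q; exact: uM.
have gq i : D i (f q.1) (X q.1 q.2) = intercept (f q.1) (X q.1 q.2) * q.2 0 i.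
  have [_ /rowP /(_ i)] := (polar_maxP _ _ (Lf Dq.1)).1 (polar_pointP Cf Lf Dq.1 Dq.2).
  by rewrite gradE => ->; rewrite mxE.
have gp i : D i (f p.1) (X p.1 p.2) = intercept (f p.1) (X p.1 p.2) * p.2 0 i.
  have [_ /rowP /(_ i)] := (polar_maxP _ _ (Lf Dp.1)).1 (polar_pointP Cf Lf Dp.1 Dp.2).
  by rewrite gradE => ->; rewrite mxE.
(* The product is split as [I(q) (q.2 - p.2) + (I(q) - I(p)) p.2], with [I] the intercept at the
   maximizer; this is why the intercept is taken at [q] here while [M q] contains [p.2]. *)
pose rhs : V := \row_i (intercept (f q.1) (X q.1 q.2) * (q.2 0 i - p.2 0 i) +
   (q.1 - p.1) * (ga (q.1, X q.1 q.2) * p.2 0 i - al i (q.1, X q.1 q.2))).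
have key : (X q.1 q.2 - X p.1 p.2) *m M q = rhs.
  apply/rowP => i; rewrite !mxE.
  under eq_bigr do rewrite !mxE mulrBr mulrA.
  rewrite sumrB -mulr_suml.
  have -> : \sum_(k < n) (X q.1 q.2 0 k - X p.1 p.2 0 k) * be i k (q.1, X q.1 q.2) =
      intercept (f q.1) (X q.1 q.2) * q.2 0 i - intercept (f p.1) (X p.1 p.2) * p.2 0 i
      - (q.1 - p.1) * al i (q.1, X q.1 q.2) by rewrite -gq -gp F1; ring.
  have -> : \sum_(k < n) (X q.1 q.2 0 k - X p.1 p.2 0 k) * ka k (q.1, X q.1 q.2) =
      intercept (f q.1) (X q.1 q.2) - intercept (f p.1) (X p.1 p.2)
      - (q.1 - p.1) * ga (q.1, X q.1 q.2) by rewrite F2; ring.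
  ring.
have -> : X q.1 q.2 0 j - X p.1 p.2 0 j = (rhs *m invmx (M q)) 0 j.
  by rewrite -key -mulmxA mulmxV // mulmx1 !mxE.
rewrite mxE mulr_sumr -big_split /=; apply: eq_bigr => i _; rewrite mxE; ring.
Unshelve. all: by end_near. Qed.

Lemma polar_point_C1 : C1_map T X.
Proof.
have cM p k i : spacetime T p -> polar_jac q k i @[q --> near_st T p] --> polar_jac p k i.
  move=> Dp; have c := polar_point_cvg_st Dp; have DX := polar_point_st Dp.
  rewrite mxE (_ : (fun q => _) = (fun q => D k (D i (f q.1)) (X q.1 q.2) -
     D k (intercept (f q.1)) (X q.1 q.2) * q.2 0 i)); last by apply/funext => q; rewrite mxE.
  apply: cvgB; first exact: (cvg_comp _ _ c (C1_cvg_D (C1Df i) DX)).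
  apply: cvgM; last exact: near_st_coord.
  exact: (cvg_comp _ _ c (C1_cvg_D (C1_intercept Cf) DX)).
have cI p k i : spacetime T p -> invmx (polar_jac q) k i @[q --> near_st T p] --> invmx (polar_jac p) k i.
  by move=> Dp; apply: cvg_invmx; [move=> k' i'; exact: cM|exact: polar_jac_unit].
split; first by move=> q Dq; case: (polar_point_st Dq).
move=> j; apply: C1_intro.
- by move=> p Dp; exact: polar_point_cdiff.
- move=> p Dp; have c := polar_point_cvg_st Dp; have DX := polar_point_st Dp.
  apply: cvg_sumr => i _; apply: cvgM; last exact: cI.
  apply: cvgB; last exact: (cvg_comp _ _ c (C1_cvg_dt (C1Df i) DX)).
  apply: cvgM; last exact: near_st_coord.
  exact: (cvg_comp _ _ c (C1_cvg_dt (C1_intercept Cf) DX)).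
- move=> i p Dp; have c := polar_point_cvg_st Dp; have DX := polar_point_st Dp.
  apply: cvgM; last exact: cI.
  exact: (cvg_comp _ _ c (C1_cvg (C1_intercept Cf) DX)).
Qed.

End Regularity.

(** * The polar of a smooth family *)

Section Dual.
Variables (R : realType) (n : nat) (T : \bar R).
Local Notation V := 'rV[R]_n.
Variable f : R -> V -> R.
Hypothesis Cf : C2_spacetime T f.
Hypothesis Lf : forall t, time_domain T t -> legendre (f t).
Hypothesis Hf : forall t x, time_domain T t -> x != 0 -> pos_def (hessian (f t) x).
Implicit Types (t : R) (x y z : V) (p q : R * V).

Let C1f : C1_spacetime T f. Proof. by case: Cf. Qed.
Let C1Df i : C1_spacetime T (fun t => 'D_(std_basis R i) (f t)).
Proof. by case: Cf => _ _; exact. Qed.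
Let C1dtf : C1_spacetime T (dt f). Proof. by case: Cf. Qed.

Local Notation X := (polar_point f).
Local Notation g := (polar_fun f).
Local Notation D i g := ('D_(std_basis R i) g).

Let C1X : C1_map T X. Proof. exact: polar_point_C1. Qed.

Lemma polar_point_neq0 t y : time_domain T t -> y != 0 -> X t y != 0.
Proof. by move=> Dt /(polar_pointP Cf Lf Dt) []. Qed.

Lemma family_gt0 t x : time_domain T t -> x != 0 -> 0 < f t x.
Proof. by move=> Dt; exact: (leg_gt0 (Lf Dt)). Qed.

Lemma family_max_gt0 t y : time_domain T t -> y != 0 -> 0 < f t (X t y).
Proof. by move=> Dt y0; apply: family_gt0 => //; exact: polar_point_neq0. Qed.

Lemma polar_eq t y : time_domain T t -> y != 0 -> g t y * f t (X t y) = dot (X t y) y - 1.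
Proof.
by move=> Dt y0; rewrite /polar_fun (negbTE y0) divfK // gt_eqF // family_max_gt0.
Qed.

Lemma polar_gt0 t y : time_domain T t -> y != 0 -> 0 < g t y.
Proof.
move=> Dt y0; rewrite -(pmulr_lgt0 _ (family_max_gt0 Dt y0)) polar_eq //.
by have [] := polar_pointP Cf Lf Dt y0.
Qed.

Lemma polar_fun0 t : g t 0 = 0. Proof. by rewrite /polar_fun eqxx. Qed.

Lemma polar_ge0 t y : time_domain T t -> 0 <= g t y.
Proof.
by move=> Dt; have [->|y0] := eqVneq y 0; [rewrite polar_fun0|exact/ltW/polar_gt0].
Qed.

Lemma polar_young t x y : time_domain T t -> dot x y - 1 <= f t x * g t y.
Proof.
move=> Dt; have [->|y0] := eqVneq y 0.
  by rewrite dot0r polar_fun0 mulr0 sub0r oppr_le0.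
have [_ _ /(_ x)] := polar_pointP Cf Lf Dt y0.
by rewrite -polar_eq // mulrAC ler_pM2r ?family_max_gt0 // mulrC.
Qed.

Lemma polar_intercept t y : time_domain T t -> y != 0 ->
  g t y * intercept (f t) (X t y) = 1.
Proof.
move=> Dt y0; have mx := polar_pointP Cf Lf Dt y0.
apply: (mulIf (lt0r_neq0 (family_max_gt0 Dt y0))).
rewrite mulrAC polar_eq // mul1r mulrC.
exact: esym (polar_max_intercept (Lf Dt) mx).
Qed.

Lemma polar_D i t y : time_domain T t -> y != 0 -> g t y * D i (f t) (X t y) = y 0 i.
Proof.
move=> Dt y0; have [_ /rowP /(_ i)] := (polar_maxP _ _ (Lf Dt)).1 (polar_pointP Cf Lf Dt y0).
by rewrite gradE => ->; rewrite mxE mulrA polar_intercept // mul1r.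
Qed.

(** The polar is the reciprocal of the intercept at the maximizer, a composition of C^1 maps. *)
Lemma C1_polar : C1_spacetime T g.
Proof.
apply: (@C1_eq _ _ _ (fun t y => (intercept (f t) (X t y))^-1)).
  move=> [t y] [Dt y0] /=; have I0 := intercept_gt0 (Lf Dt) (polar_point_neq0 Dt y0).
  by apply: (mulIf (lt0r_neq0 I0)); rewrite polar_intercept // mulVf // gt_eqF.
apply: C1V; last exact: (C1_comp (C1_intercept Cf) C1X).
move=> [t y] [Dt y0] /=.
by rewrite gt_eqF // intercept_gt0 ?polar_point_neq0 //; exact: Lf.
Qed.

(** Derivatives of the two sides of [g t y * f t (X t y) = dot (X t y) y - 1]; comparing them yields
    [dt_polar] and [D_polar]. *)
Let polar_cdiff p (Dp : spacetime T p) :=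
  cdiffM (C1_cdiff C1_polar Dp) (C1_comp_cdiff C1f C1X Dp).

Let dot_cdiff p (Dp : spacetime T p) :=
  cdiffD (cdiff_sum (fun j => cdiffM (C1_cdiff (C1X.2 j) Dp) (cdiff_coord T j p)))
    (cdiff_cst T (-1) p).

(** Envelope theorem: the terms with the derivative of [X] cancel because [g * grad f = y] at the
    maximizer. *)
Lemma dt_polar t y : spacetime T (t, y) ->
  dt g t y = - (g t y * (dt f t (X t y) / f t (X t y))).
Proof.
move=> Dp; have [Dt y0] := Dp.
have E1 := (cdiff_dt Dp (polar_cdiff Dp)).2.
have := cdiff_eq (G := fun t y => g t y * f t (X t y)) Dp _ (dot_cdiff Dp).
move=> /(_ _)/(cdiff_dt Dp) [|_].
  by move=> [s z] [Ds z0] /=; rewrite polar_eq.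
rewrite {}E1 /= addr0 => /eqP.
under [X in _ == X]eq_bigr do rewrite mulr0 addr0.
have -> : \sum_j dt (fun s z => X s z 0 j) t y * y 0 j =
    g t y * \sum_j dt (fun s z => X s z 0 j) t y * D j (f t) (X t y).
  by rewrite mulr_sumr; apply: eq_bigr => j _; rewrite mulrCA polar_D.
rewrite mulrDr addrA => /eqP /(canRL (addrK _)); rewrite subrr => /eqP.
rewrite addr_eq0 => /eqP E.
apply: (mulIf (lt0r_neq0 (family_max_gt0 Dt y0))).
by rewrite E mulNr mulrA divfK // gt_eqF // family_max_gt0.
Qed.

Lemma D_polar i t y : spacetime T (t, y) -> D i (g t) y = X t y 0 i / f t (X t y).
Proof.
move=> Dp; have [Dt y0] := Dp.
have E1 := (cdiff_D i Dp (polar_cdiff Dp)).2.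
have := cdiff_eq (G := fun t y => g t y * f t (X t y)) Dp _ (dot_cdiff Dp).
move=> /(_ _)/(cdiff_D i Dp) [|_].
  by move=> [s z] [Ds z0] /=; rewrite polar_eq.
rewrite {}E1 /= addr0 => /eqP; rewrite big_split /=.
have -> : \sum_j X t y 0 j * (i == j)%:R = X t y 0 i.
  rewrite (bigD1 i) //= eqxx mulr1 big1 ?addr0 // => j.
  by rewrite eq_sym => /negbTE ->; rewrite mulr0.
have -> : \sum_j D i (fun z => X t z 0 j) y * y 0 j =
    g t y * \sum_j D i (fun z => X t z 0 j) y * D j (f t) (X t y).
  by rewrite mulr_sumr; apply: eq_bigr => j _; rewrite mulrCA polar_D.
move=> /eqP /(canRL (addrK _)); rewrite [_ + X t y 0 i]addrC addrK => E.
by apply: (mulIf (lt0r_neq0 (family_max_gt0 Dt y0))); rewrite E divfK // gt_eqF // family_max_gt0.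
Qed.

Lemma C1_inv_family_max : C1_spacetime T (fun t y => (f t (X t y))^-1).
Proof.
apply: C1V; last exact: (C1_comp C1f C1X).
by move=> [t y] [Dt y0] /=; rewrite gt_eqF // family_max_gt0.
Qed.

(** By the envelope formulas the first derivatives of [g] are built from [X], [f], [dt f] and [g]
    themselves, all of class C^1. *)
Lemma C2_polar : C2_spacetime T g.
Proof.
split; first exact: C1_polar.
- apply: (@C1_eq _ _ _ (fun t y => - (g t y * (dt f t (X t y) * (f t (X t y))^-1)))).
    by move=> [t y] Dp /=; rewrite dt_polar.
  apply: C1N; apply: C1M; first exact: C1_polar.
  by apply: C1M; [exact: (C1_comp C1dtf C1X)|exact: C1_inv_family_max].
- move=> i; apply: (@C1_eq _ _ _ (fun t y => X t y 0 i * (f t (X t y))^-1)).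
    by move=> [t y] Dp /=; rewrite D_polar.
  by apply: C1M; [exact: C1X.2|exact: C1_inv_family_max].
Qed.

(** Let [z] be the derivative of [X] in the direction [w]. Differentiating the first-order condition
    expresses [w] through [Hess f z], and the quadratic form of [Hess g] at [w] becomes that of
    [Hess f] at [z] divided by [c * F]. If [z] were 0, so would be [w]. *)
Lemma polar_pos_def t y : time_domain T t -> y != 0 -> pos_def (hessian (g t) y).
Proof.
move=> Dt y0 w w0; have Dp : spacetime T (t, y) by [].
have DX := polar_point_st Cf Lf Dp; rewrite /= in DX.
have fX_gt0 := family_max_gt0 Dt y0; have x0 := polar_point_neq0 Dt y0.
have c0 := intercept_gt0 (Lf Dt) x0.
have cgt := polar_intercept Dt y0; have feq := polar_eq Dt y0; have grd := fun i => polar_D i Dt y0.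
have gt0 := polar_gt0 Dt y0.
pose J j k := D j (fun z => X t z 0 k) y.
pose z : V := \row_k \sum_j w 0 j * J j k.
pose Hz i := \sum_k D k (D i (f t)) (X t y) * z 0 k.
have HE i j : hessian (g t) y i j = J j i / f t (X t y)
   - X t y 0 i * (\sum_k J j k * D k (f t) (X t y)) / f t (X t y) ^+ 2.
  rewrite mxE.
  have h := cdiffM (C1_cdiff (C1X.2 i) Dp) (cdiffV (lt0r_neq0 fX_gt0 : f (t,y).1 (X (t, y).1 (t, y).2) != 0) (C1_comp_cdiff C1f C1X Dp)).
  have {}h := cdiff_eq (G := fun t y => D i (g t) y) Dp _ h.
  rewrite (cdiff_D j Dp (h _)).2 /=; last by move=> [s x] Dq /=; rewrite D_polar.
  by rewrite -/(J j i) mulNr mulrN mulrA.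
(* The relation [grad f = intercept * y] at [X t y], differentiated with respect to the [j]-th
   coordinate of [y]. *)
have FOC i j : \sum_k J j k * D k (D i (f t)) (X t y) =
    (\sum_k J j k * D k (intercept (f t)) (X t y)) * y 0 i + intercept (f t) (X t y) * (j == i)%:R.
  have h := cdiffM (C1_comp_cdiff (C1_intercept Cf) C1X Dp) (cdiff_coord T i (t, y)).
  have {}h := cdiff_eq (G := fun t y => D i (f t) (X t y)) Dp _ h.
  rewrite -(cdiff_D j Dp (C1_comp_cdiff (C1Df i) C1X Dp)).2 /=.
  rewrite (cdiff_D j Dp (h _)).2 //= => -[s x] [Ds x0'] /=.
  have := polar_D i Ds x0' => /(congr1 ( *%R (intercept (f s) (X s x)))) <-.
  by rewrite mulrA [intercept _ _ * _]mulrC polar_intercept // mul1r.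
set x := X t y in x0 c0 fX_gt0 cgt feq grd HE FOC Hz DX *.
set c := intercept (f t) x in c0 cgt FOC *.
set F := f t x in fX_gt0 feq HE *.
(* By [D_intercept] this is also the derivative of the intercept along [z]. *)
pose s := \sum_i x 0 i * Hz i.
have zE k : z 0 k = \sum_j w 0 j * J j k by rewrite mxE.
have HzE i : Hz i = s * y 0 i + c * w 0 i.
  have -> : Hz i = \sum_j w 0 j * \sum_k J j k * D k (D i (f t)) x.
    rewrite /Hz; under eq_bigr do rewrite zE mulr_sumr.
    rewrite exchange_big /=; apply: eq_bigr => j _; rewrite mulr_sumr.
    by apply: eq_bigr => k _; rewrite mulrCA; congr (_ * _); rewrite mulrC.
  under eq_bigr do rewrite FOC mulrDr !mulrA.
  rewrite big_split /= -mulr_suml; congr (_ * _ + _).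
    rewrite /s /Hz.
    under eq_bigr do rewrite mulr_sumr.
    under [RHS]eq_bigr do rewrite mulr_sumr.
    rewrite exchange_big [RHS]exchange_big /=; apply: eq_bigr => k _.
    rewrite zE (D_intercept Cf _ DX).
    under [RHS]eq_bigr do rewrite mulrA.
    rewrite -mulr_suml mulrC mulr_suml; apply: eq_bigr => j _.
    by rewrite mulrA.
  rewrite (bigD1 i) //= eqxx mulr1 big1 ?addr0; first by rewrite mulrC.
  by move=> j /negbTE ->; rewrite !mulr0.
have wE i : w 0 i = (Hz i - s * y 0 i) / c.
  by rewrite HzE addrAC subrr add0r [c * _]mulrC mulfK // gt_eqF.
have QE : quad_form (hessian (g t) y) w = (\sum_i z 0 i * Hz i) / (c * F).
  have grc k : D k (f t) x = c * y 0 k.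
    by rewrite -grd mulrA [c * _]mulrC cgt mul1r.
  have Hw i : \sum_j w 0 j * hessian (g t) y i j =
      z 0 i / F - x 0 i * (c * dot z y) / F ^+ 2.
    under eq_bigr do rewrite HE mulrBr.
    rewrite sumrB; congr (_ - _).
      by rewrite zE mulr_suml; apply: eq_bigr => j _; rewrite mulrA.
    have -> : c * dot z y = \sum_j w 0 j * \sum_k J j k * D k (f t) x.
      rewrite /dot mulr_sumr.
      under eq_bigr do rewrite mulrCA -grc zE mulr_suml.
      rewrite exchange_big /=; apply: eq_bigr => j _; rewrite mulr_sumr.
      by apply: eq_bigr => k _; rewrite mulrA.
    rewrite mulr_sumr mulr_suml; apply: eq_bigr => j _; ring.
  have wz : \sum_i w 0 i * z 0 i = (\sum_i z 0 i * Hz i - s * dot z y) / c.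
    rewrite /dot mulr_sumr -sumrB mulr_suml; apply: eq_bigr => i _.
    rewrite wE; ring.
  have wx : \sum_i w 0 i * x 0 i = (s - s * dot x y) / c.
    rewrite {1}/s /dot mulr_sumr -sumrB mulr_suml; apply: eq_bigr => i _.
    rewrite wE; ring.
  have -> : quad_form (hessian (g t) y) w =
      (\sum_i w 0 i * z 0 i) / F - (\sum_i w 0 i * x 0 i) * (c * dot z y) / F ^+ 2.
    rewrite /quad_form {1}/dot.
    have wH i : (w *m (hessian (g t) y)^T) 0 i = z 0 i / F - x 0 i * (c * dot z y) / F ^+ 2.
      by rewrite mxE -Hw; apply: eq_bigr => j _; rewrite [in LHS]mxE.
    under eq_bigr do rewrite wH mulrBr.
    rewrite sumrB; congr (_ - _); rewrite !mulr_suml; apply: eq_bigr => i _; ring.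
  rewrite wz wx.
  (* From [g F = <x, y> - 1] and [g = 1 / c]; with this value all terms containing [s] cancel. *)
  have -> : dot x y = 1 + F / c.
    have gE : g t y = c^-1 by apply: (mulIf (lt0r_neq0 c0)); rewrite cgt mulVf // gt_eqF.
    by rewrite -[LHS](subrK 1) -feq gE addrC [_ * F]mulrC.
  by field; rewrite !gt_eqF.
rewrite QE divr_gt0 ?mulr_gt0 //.
have z0 : z != 0.
  apply: contra w0 => /eqP z0; apply/eqP/rowP => i.
  have h k : Hz k = 0 by rewrite /Hz big1 // => l _; rewrite z0 mxE mulr0.
  by rewrite wE h /s big1 ?mul0r ?subrr ?mul0r ?mxE // => k _; rewrite h mulr0.
have := Hf Dt x0 z0; rewrite /quad_form /dot.
rewrite (_ : \sum_i z 0 i * (z *m (hessian (f t) x)^T) 0 i = \sum_i z 0 i * Hz i) //.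
apply: eq_bigr => i _; congr (_ * _); rewrite mxE; apply: eq_bigr => k _.
by rewrite !mxE mulrC.
Qed.

(** Maximality is equality in [polar_young], a condition symmetric in [f] and [g]; so [y] is the
    maximizer of [g] at [x]. In particular every nonzero [x] is a value of [X t]. *)
Lemma polar_max_polar t x : time_domain T t -> x != 0 ->
  polar_max (g t) x ((intercept (f t) x)^-1 *: grad (f t) x) /\
  X t ((intercept (f t) x)^-1 *: grad (f t) x) = x.
Proof.
move=> Dt x0; set y := _ *: _; have I0 := intercept_gt0 (Lf Dt) x0.
have mx : polar_max (f t) y x.
  by apply/(polar_maxP _ _ (Lf Dt)); split => //; rewrite scalerA divff ?scale1r // gt_eqF.
have Xy := polar_point_unique Cf Lf Dt mx.
have y0 := polar_max_neq0 mx; split => //; split => //.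
  by have [_ + _] := mx; rewrite dotC.
move=> z; have := polar_eq Dt y0; rewrite Xy => E.
rewrite [dot y x]dotC -E mulrC -mulrA ler_pM2l ?polar_gt0 // dotC.
exact: polar_young.
Qed.

Lemma polar_polar t : time_domain T t -> polar (EFin \o g t) = EFin \o f t.
Proof.
move=> Dt; apply/funext => x /=; have [->|x0] := eqVneq x 0.
  by rewrite polar0 (leg0 (Lf Dt)).
have [mx Xy] := polar_max_polar Dt x0; set y := _ *: _ in mx Xy.
have [y0 _ _] := mx; rewrite (polar_val mx) ?polar_gt0 //; congr (_%:E).
apply: (mulIf (lt0r_neq0 (polar_gt0 Dt y0))).
by rewrite divfK ?gt_eqF ?polar_gt0 // dotC -{1}Xy -polar_eq // Xy mulrC.
Qed.

(* If [g] stays within [b] of [s |-> a s] along the ray of [y], then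
   [a f >= <., y>], and the maximizers [X t (s y)], rescaled to a fixed sphere,
   tend as [s] grows to a point of equality, against strict convexity. *)
Lemma polar_nonlinear t y : time_domain T t -> y != 0 -> ~ exists a b : R, [/\ 0 <= a, 0 < b &
    forall s : R, 0 <= s -> a * s - b <= g t (s *: y) /\ g t (s *: y) <= a * s].
Proof.
move=> Dt y0 [a [b [a0 b0 H]]]; have L := Lf Dt.
have {}a0 : 0 < a.
  have [_] := H 1 ler01; rewrite scale1r mulr1; apply: lt_le_trans; exact: polar_gt0.
have sy s : 0 < s -> s *: y != 0 by move=> s0; rewrite scaler_eq0 negb_or y0 andbT gt_eqF.
have f_ge0 x : 0 <= f t x.
  by have [->|x0] := eqVneq x 0; [rewrite (leg0 L)|exact/ltW/family_gt0].
have Hi x : dot x y <= a * f t x.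
  rewrite leNgt; apply/negP => h; pose d := dot x y - a * f t x.
  have d0 : 0 < d by rewrite subr_gt0.
  (* [polar_young] at [r *: y] would give [r * d <= 1]. *)
  pose r := 2 / d; have r0 : 0 < r by rewrite divr_gt0.
  have := polar_young x (r *: y) Dt; rewrite dotZr.
  have [_ h2] := H r (ltW r0).
  have h3 : f t x * g t (r *: y) <= f t x * (a * r) by apply: ler_wpM2l.
  have h4 : r * d = 2 by rewrite divfK // gt_eqF.
  move: h4; rewrite /d; nra.
pose q x := a * f t x - dot x y.
(* Equality at [x] would make [f] linear on the segment from [0] to [x]. *)
have q_gt0 x : x != 0 -> 0 < q x.
  move=> x0; rewrite subr_gt0 lt_neqAle Hi andbT; apply/negP => /eqP E.
  apply: (leg_strict L x0) => s s0 s1; apply/eqP; rewrite eq_le leg_conv //=.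
  rewrite (leg0 L) mulr0 addr0 scaler0 addr0 -(ler_pM2l a0) mulrCA -E -dotZl.
  exact: Hi.
have q_scale l x : 0 <= l -> l <= 1 -> q (l *: x) <= l * q x.
  move=> l0 l1; rewrite /q mulrBr dotZl lerB // mulrCA ler_pM2l //.
  have := leg_conv L x 0 l0 l1; rewrite scaler0 addr0 (leg0 L) mulr0 addr0 //.
pose N := n%:R * `|y| + 1; have N0 : 0 < N by rewrite ltr_wpDl // mulr_ge0.
pose rho := a / (2 * b) / N; have rho0 : 0 < rho by rewrite !divr_gt0 // mulr_gt0.
(* The threshold makes [b] at most half of [a s]. Then the maximizer for [s *: y] stays away from 0,
   its gap [q] is at most [b f / s], and [f] there is bounded linearly in the norm. *)
have big s : 2 * b / a <= s -> 0 < s -> [/\ rho <= `|X t (s *: y)|,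
    s * q (X t (s *: y)) <= b * f t (X t (s *: y)) &
    a * f t (X t (s *: y)) <= 2 * N * `|X t (s *: y)| ].
  move=> sb s0; have E := polar_eq Dt (sy s s0); set x := X t _ in E *.
  have F0 : 0 < f t x := family_max_gt0 Dt (sy s s0).
  rewrite dotZr in E.
  have h1 : (a * s - b) * f t x <= s * dot x y - 1.
    by rewrite -E ler_pM2r //; have [] := H s (ltW s0).
  have h2 := Hi x.
  have h3 : 1 <= b * f t x by move: h1 h2; nra.
  have h4 : 2 * b <= s * a by rewrite -ler_pdivrMr.
  have h5 : a * f t x <= 2 * dot x y.
    rewrite -(ler_pM2l s0); move: h1 h4 F0; nra.
  have h6 : dot x y <= N * `|x|.
    apply: le_trans (ler_norm _) _; apply: le_trans (dot_le x y) _.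
    rewrite mulrCA [leRHS]mulrC; apply: ler_wpM2l => //.
    by rewrite /N lerDl.
  split.
  - rewrite /rho ler_pdivrMr // ler_pdivrMr ?mulr_gt0 // [`|x| * N]mulrC.
    have h7 : a <= b * (a * f t x) by rewrite mulrCA ler_peMr // ltW.
    apply: le_trans h7 _; rewrite -mulrA; move: h5 h6 b0; nra.
  - by move: h1; rewrite /q; nra.
  - by apply: le_trans h5 _; rewrite -mulrA ler_pM2l.
pose S := [set x : V | `|x| = 1].
have S0 x : S x -> rho *: x != 0.
  by move=> x1; rewrite scaler_eq0 negb_or gt_eqF //= -normr_gt0 x1.
pose s1 := 2 * b / a; have s10 : 0 < s1 by rewrite divr_gt0 // mulr_gt0.
have unit x : x != 0 -> S (`|x|^-1 *: x).
  by move=> x0; rewrite /S /= normrZ normfV normr_id mulVf // normr_eq0.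
have Sne : S !=set0.
  by exists (`|y|^-1 *: y); exact: unit.
have qc (z : V) (FI : set_system V) : Filter FI -> FI --> z -> S z ->
    q (rho *: w) @[w --> FI] --> q (rho *: z).
  move=> FF FIz Sz; apply: cvgB.
    apply: cvgM; first exact: cvg_cst.
    have c : rho *: w @[w --> FI] --> rho *: z by apply: cvgZr.
    exact: (cvg_comp _ _ c (C1_on_cvg (leg_C1 L) (S0 z Sz))).
  apply: cvg_dot => i; last exact: cvg_cst.
  rewrite mxE (_ : (fun x => _) = (fun x : V => rho * x 0 i)).
    apply: cvgM; first exact: cvg_cst.
    exact: (cvg_comp _ _ FIz (@coord_continuous _ _ _ 0 i z)).
  by apply/funext => x; rewrite mxE.
have [|z Sz Hz] := @EVT_min_rV _ _ (fun x => q (rho *: x)) S Sne (@sphere_compact R n).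
  by apply/subspace_continuousP => z Sz; apply: qc => //; exact: cvg_within.
rewrite inE in Sz; pose m := q (rho *: z).
have m0 : 0 < m by apply: q_gt0; exact: S0.
have ma0 : 0 < m * a by rewrite mulr_gt0.
(* The three estimates of [big], together with the minimum [m] of the gap on the sphere of radius
   [rho], bound [s] by [K]; the next choice of [s] exceeds it. *)
pose K := rho * b * 2 * N / (m * a).
have K0 : 0 < K.
  by apply: divr_gt0 => //; apply: mulr_gt0 => //; apply: mulr_gt0 => //; apply: mulr_gt0.
pose s := s1 + K + 1.
have s0 : 0 < s by rewrite /s; lra.
have s1s : s1 <= s by rewrite /s; lra.
have [h1 h2 h3] := big s s1s s0.
set x := X t (s *: y) in h1 h2 h3.
have x0 : 0 < `|x| by apply: lt_le_trans h1.
have xn0 : x != 0 by rewrite -normr_gt0.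
have := Hz (`|x|^-1 *: x); rewrite inE => /(_ (unit x xn0)); rewrite -/m scalerA => h4.
have h5 : q (rho / `|x| *: x) <= rho / `|x| * q x.
  by apply: q_scale; [rewrite divr_ge0 ?ltW|rewrite ler_pdivrMr // mul1r].
have h6 : m * `|x| <= rho * q x.
  have := le_trans h4 h5; rewrite mulrAC ler_pdivlMr //.
have h7 : s * (m * a) <= rho * b * 2 * N.
  rewrite -(ler_pM2r x0).
  have e1 : s * (m * a) * `|x| <= s * a * (rho * q x).
    by rewrite (_ : s * (m * a) * `|x| = s * a * (m * `|x|)); [rewrite ler_pM2l ?mulr_gt0|ring].
  apply: le_trans e1 _.
  have ar0 : 0 < a * rho by exact: mulr_gt0.
  have e2 : s * a * (rho * q x) <= a * rho * (b * f t x).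
    by rewrite (_ : s * a * (rho * q x) = a * rho * (s * q x)); [rewrite ler_pM2l|ring].
  apply: le_trans e2 _.
  rewrite (_ : a * rho * (b * f t x) = rho * b * (a * f t x)); last by ring.
  have -> : rho * b * 2 * N * `|x| = rho * b * (2 * N * `|x|) by ring.
  by rewrite ler_pM2l // mulr_gt0.
by move: h7; rewrite -ler_pdivlMr // -/K /s; lra.
Qed.

(** Convexity is [polar_young] at the maximizer of the intermediate point; strict convexity is dual
    to the differentiability of [f]. *)
Lemma legendre_polar t : time_domain T t -> legendre (g t).
Proof.
move=> Dt; split.
- exact: polar_fun0.
- by move=> y y0; exact: polar_gt0.
- move=> y1 y2 s s0 s1; have [E|y0] := eqVneq (s *: y1 + (1 - s) *: y2) 0.
    rewrite E polar_fun0 addr_ge0 // mulr_ge0 // ?polar_ge0 //.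
    by rewrite subr_ge0.
  have fx := family_max_gt0 Dt y0.
  rewrite -(ler_pM2r fx) polar_eq // dotDr !dotZr.
  set x := X _ _ in fx *.
  have h1 := polar_young x y1 Dt; have h2 := polar_young x y2 Dt.
  have : s * (dot x y1 - 1) + (1 - s) * (dot x y2 - 1) <= s * (f t x * g t y1) + (1 - s) * (f t x * g t y2).
    by apply: lerD; apply: ler_wpM2l => //; rewrite subr_ge0.
  have -> : s * (dot x y1 - 1) + (1 - s) * (dot x y2 - 1) = s * dot x y1 + (1 - s) * dot x y2 - 1 by ring.
  by move=> h; apply: le_trans h _; rewrite le_eqVlt; apply/orP; left; apply/eqP; ring.
- exact: C1_spacetime_on C1_polar Dt.
- move=> y1 y2 y12 aff.
  (* Maximizers exist only at nonzero points. If the midpoint is 0, the point with weight 1/3 is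
     not, since [y1 != y2]. *)
  have [s [s0 s1 y0]] : exists s : R, [/\ 0 < s, s < 1 & s *: y1 + (1 - s) *: y2 != 0].
    have [E|h] := eqVneq ((2^-1 : R) *: y1 + (1 - 2^-1) *: y2) 0; last first.
      by exists 2^-1; split => //; lra.
    exists 3^-1; split; [lra|lra|].
    apply: contra y12 => /eqP E'; rewrite -subr_eq0.
    have : (2^-1 - 3^-1 : R) *: (y1 - y2) = 0.
      rewrite -[RHS](subrr 0) -{1}E -E' opprD addrACA -scalerBl -scalerBl.
      by rewrite scalerBr -scaleNr; congr (_ + _ *: _); ring.
    move/eqP; rewrite scaler_eq0 => /orP[/eqP h|//].
    by move: h; lra.
  set y := _ + _ in y0; have fx := family_max_gt0 Dt y0; pose x := X t y.
  have Ey := polar_eq Dt y0; have := aff s (ltW s0) (ltW s1); rewrite -/y => Ea.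
  have h1 := polar_young x y1 Dt; have h2 := polar_young x y2 Dt.
  rewrite Ea /y dotDr !dotZr -/y -/x in Ey.
  (* Equality in the convex combination of two Young inequalities with positive weights forces
     equality in each. *)
  have E1 : dot x y1 - 1 = f t x * g t y1.
    apply/eqP; rewrite eq_le h1 /=; nra.
  have E2 : dot x y2 - 1 = f t x * g t y2.
    apply/eqP; rewrite eq_le h2 /=; nra.
  have mx z : dot x z - 1 = f t x * g t z -> polar_max (f t) z x.
    move=> E; have z0 : z != 0.
      apply: contra_eq_neq E => ->; rewrite dot0r polar_fun0 mulr0 sub0r.
      by rewrite oppr_eq0 oner_neq0.
    split; first exact: polar_point_neq0.
      by rewrite E mulr_gt0 // polar_gt0.
    move=> w; rewrite E mulrC -mulrA ler_pM2l // mulrC; exact: polar_young.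
  (* The point [x] is now a maximizer for both [y1] and [y2], and its single gradient determines
     both. *)
  have [x0 G1] := (polar_maxP _ _ (Lf Dt)).1 (mx _ E1).
  have [_ G2] := (polar_maxP _ _ (Lf Dt)).1 (mx _ E2).
  have I0 := intercept_gt0 (Lf Dt) x0.
  move/eqP: y12; apply; apply: (scalerI (lt0r_neq0 I0)).
  by rewrite -G1 -G2.
- by move=> y y0; exact: polar_nonlinear.
Qed.

(** * The second time derivative of the polar *)

Let vel t x := dt f t x / f t x.

Let C1vel : C1_spacetime T vel.
Proof.
apply: C1M => //; apply: C1V => // -[t x] [Dt x0] /=.
by rewrite gt_eqF // family_gt0.
Qed.

Lemma dt_polar_point i t y : spacetime T (t, y) ->
  \sum_j dt (fun s z => X s z 0 j) t y * D j (D i (f t)) (X t y)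
  = - (f t (X t y) * D i (vel t) (X t y)).
Proof.
move=> Dp; have [Dt y0] := Dp; have DX := polar_point_st Cf Lf Dp; rewrite /= in DX.
have fX_gt0 := family_max_gt0 Dt y0; have g0 := polar_gt0 Dt y0.
have h := cdiffM (C1_cdiff C1_polar Dp) (C1_comp_cdiff (C1Df i) C1X Dp).
have {}h := cdiff_eq (G := fun _ x => x 0 i) Dp _ h.
have := (cdiff_dt Dp (h _)).2.
rewrite (cdiff_dt Dp (cdiff_coord T i (t, y))).2 /= => H0.
have {H0} : dt g t y * D i (f t) (X t y) + g t y * (dt (fun s => D i (f s)) t (X t y) +
    \sum_j dt (fun s z => X s z 0 j) t y * D j (D i (f t)) (X t y)) = 0.
  by apply/esym/H0 => -[s z] [Ds z0] /=; rewrite polar_D.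
have -> : D i (vel t) (X t y) = D i (dt f t) (X t y) / f t (X t y)
    - dt f t (X t y) * D i (f t) (X t y) / f t (X t y) ^+ 2.
  have h' := cdiffM (C1_cdiff C1dtf DX) (cdiffV (lt0r_neq0 fX_gt0 : f (t, X t y).1 (t, X t y).2 != 0) (C1_cdiff C1f DX)).
  by rewrite (cdiff_D i DX h').2 /=; ring.
rewrite dt_polar // (schwarz_st i Cf DX) /= => H1.
move: H1; move: (\sum_(j < n) _) => S H1.
apply: (mulfI (lt0r_neq0 g0)); apply/eqP; rewrite -subr_eq0; apply/eqP; rewrite -[RHS]H1 /=.
by field; rewrite gt_eqF.
Qed.

Lemma polar_flow_equation t y : spacetime T (t, y) ->
  dt (dt g) t y = g t y * f t (X t y) *
    (dt (dt (fun s z => (f s z)^-1)) t (X t y) +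
     quad_form (invmx (hessian (f t) (X t y))) (grad (vel t) (X t y))).
Proof.
move=> Dp; have [Dt y0] := Dp; have DX := polar_point_st Cf Lf Dp; rewrite /= in DX.
have fX_gt0 := family_max_gt0 Dt y0; have g0 := polar_gt0 Dt y0; have x0 := polar_point_neq0 Dt y0.
pose del : V := \row_j dt (fun s z => X s z 0 j) t y.
have E1 : dt (dt g) t y = - (dt g t y * vel t (X t y) +
    g t y * (dt vel t (X t y) + \sum_j del 0 j * D j (vel t) (X t y))).
  have h := cdiffM (cdiff_cst T (-1) (t, y)) (cdiffM (C1_cdiff C1_polar Dp) (C1_comp_cdiff C1vel C1X Dp)).
  have {}h := cdiff_eq (G := dt g) Dp _ h.
  rewrite (cdiff_dt Dp (h _)).2 /=; last by move=> [s z] Dq /=; rewrite dt_polar // mulN1r.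
  rewrite mul0r add0r mulN1r; congr (- (_ + _ * (_ + _))).
  by apply: eq_bigr => j _; rewrite mxE.
have E2 s z : spacetime T (s, z) -> dt (fun s z => (f s z)^-1) s z = - (vel s z * (f s z)^-1).
  move=> Dq; have [Ds z0] := Dq; have fz := family_gt0 Ds z0.
  have h := cdiffV (lt0r_neq0 fz : f (s, z).1 (s, z).2 != 0) (C1_cdiff C1f Dq).
  by rewrite (cdiff_dt Dq h).2 /= /vel; field; rewrite gt_eqF.
have E3 : dt (dt (fun s z => (f s z)^-1)) t (X t y) =
    - (dt vel t (X t y) / f t (X t y) - vel t (X t y) ^+ 2 / f t (X t y)).
  have h := cdiffM (cdiff_cst T (-1) (t, X t y)) (cdiffM (C1_cdiff C1vel DX) (cdiffV (lt0r_neq0 fX_gt0 : f (t, X t y).1 (t, X t y).2 != 0) (C1_cdiff C1f DX))).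
  have {}h := cdiff_eq (G := dt (fun s z => (f s z)^-1)) DX _ h.
  rewrite (cdiff_dt DX (h _)).2 /=; last by move=> [s z] Dq /=; rewrite E2 // mulN1r.
  by rewrite /vel; field; rewrite gt_eqF.
set H := hessian (f t) (X t y); set W := grad (vel t) (X t y).
have uH : H \in unitmx.
  rewrite -unitmx_tr -row_free_unit; apply/inj_row_free => z zH.
  apply/eqP/negPn/negP => /(Hf Dt x0); rewrite /quad_form -/H zH dot0r ltxx //.
have delE : del *m H^T = - (f t (X t y)) *: W.
  apply/rowP => i; rewrite mxE [RHS]mxE gradE mulNr -dt_polar_point //.
  by apply: eq_bigr => j _; rewrite !mxE.
(* Inverting [delE] turns the quadratic form into the transport term of [E1], the derivative of
   [vel] along the motion of the maximizer. *)
have Q : f t (X t y) * quad_form (invmx H) W = - \sum_j del 0 j * D j (vel t) (X t y).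
  have -> : del = - (f t (X t y)) *: (W *m (invmx H)^T).
    by rewrite scalemxAl -delE -mulmxA -trmx_mul mulVmx // trmx1 mulmx1.
  rewrite /quad_form /dot mulr_sumr -sumrN; apply: eq_bigr => j _.
  rewrite [X in _ = - (X * _)]mxE [W 0 j]gradE; ring.
rewrite -[RHS]mulrA [f t (X t y) * _]mulrDr Q E1 dt_polar // E3 -/(vel t (X t y)).
by field; rewrite gt_eqF.
Qed.

End Dual.

(** * Linear flows of polars *)

Section Combination.
Variables (R : realType) (n : nat).
Local Notation V := 'rV[R]_n.
Implicit Types (f h : V -> R) (x y z : V) (a b : R).
Local Notation D i g := ('D_(std_basis R i) g).

Lemma C1_comb f h a b : C1_on (@punctured R n) f -> C1_on (@punctured R n) h ->
  C1_spacetime +oo (fun (_ : R) z => a * f z + b * h z).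
Proof.
by move=> Cf Ch; apply: C1D; (apply: C1M; [exact: C1_cst|exact: C1_on_spacetime]).
Qed.

Lemma zero_time : time_domain (+oo%E : \bar R) 0. Proof. by split => //; exact: ltry. Qed.

Lemma D_comb f h a b i x : C1_on (@punctured R n) f -> C1_on (@punctured R n) h -> x != 0 ->
  D i (fun z => a * f z + b * h z) x = a * D i f x + b * D i h x.
Proof.
move=> Cf Ch x0; have Dp := punctured_st x0 (lexx 0).
have d := cdiffD (cdiffM (cdiff_cst _ a (0, x)) (C1_cdiff (C1_on_spacetime _ Cf) Dp))
  (cdiffM (cdiff_cst _ b (0, x)) (C1_cdiff (C1_on_spacetime _ Ch) Dp)).
by rewrite (cdiff_D i Dp d).2 /= !mul0r !add0r.
Qed.

Lemma C2_comb f h a b : C2_on (@punctured R n) f -> C2_on (@punctured R n) h ->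
  C2_on (@punctured R n) (fun z => a * f z + b * h z).
Proof.
move=> [Cf CDf] [Ch CDh]; split; first exact: (C1_spacetime_on (C1_comb a b Cf Ch) zero_time).
move=> i; apply: (@C1_spacetime_on _ _ +oo (fun=> D i (fun z => a * f z + b * h z)) 0) zero_time.
apply: (@C1_eq _ _ _ (fun _ z => a * D i f z + b * D i h z)); last exact: C1_comb.
by move=> [t x] [_ x0] /=; rewrite D_comb.
Qed.

Lemma hessianE f x i j : hessian f x i j = D j (D i f) x.
Proof. by rewrite mxE. Qed.

Lemma comb_mxE (A B : 'M[R]_n) a b i j : (a *: A + b *: B) i j = a * A i j + b * B i j.
Proof. by rewrite !mxE. Qed.

Lemma hessian_comb f h a b x : C2_on (@punctured R n) f -> C2_on (@punctured R n) h -> x != 0 ->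
  hessian (fun z => a * f z + b * h z) x = a *: hessian f x + b *: hessian h x.
Proof.
move=> [Cf CDf] [Ch CDh] x0; have Dp := punctured_st x0 (lexx 0).
apply/matrixP => i j; apply: etrans (hessianE _ x i j) _.
apply: etrans _ (esym (comb_mxE (hessian f x) (hessian h x) a b i j)).
apply: etrans _ (f_equal2 (fun p q => a * p + b * q) (esym (hessianE f x i j)) (esym (hessianE h x i j))).
have d := C1_cdiff (C1_comb a b (CDf i) (CDh i)) Dp.
have d' := cdiff_eq (G := fun _ => D i (fun z => a * f z + b * h z)) Dp _ d.
rewrite (cdiff_D j Dp (d' _)).2 /=; first exact: D_comb.
by move=> [t z] [_ z0] /=; rewrite D_comb.
Qed.

Lemma pos_def_comb (A B : 'M[R]_n) a b : 0 < a -> 0 <= b -> pos_def A -> pos_def B ->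
  pos_def (a *: A + b *: B).
Proof.
move=> a0 b0 pA pB z z0.
have -> : quad_form (a *: A + b *: B) z = a * quad_form A z + b * quad_form B z.
  by rewrite /quad_form linearD !linearZ /= mulmxDr -!scalemxAr dotDr !dotZr.
by rewrite ltr_wpDr ?mulr_gt0 ?pA // mulr_ge0 // ltW // pB.
Qed.

(** Strictness passes over from [f] because its weight is positive. For nonlinearity, the weighted
    tangent lines of [f] and [h] at a far point replace those of the sum. *)
Lemma legendre_comb f h a : 0 < a -> a <= 1 -> legendre f -> legendre h ->
  legendre (fun z => a * f z + (1 - a) * h z).
Proof.
move=> a0 a1 Lf Lh; have b0 : 0 <= 1 - a by rewrite subr_ge0.
have ge0 (k : V -> R) : legendre k -> forall x, 0 <= k x.
  by move=> L x; have [->|x0] := eqVneq x 0; [rewrite (leg0 L)|exact/ltW/(leg_gt0 L)].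
split.
- by rewrite (leg0 Lf) (leg0 Lh) !mulr0 addr0.
- by move=> x x0; rewrite ltr_wpDr ?mulr_gt0 ?(leg_gt0 Lf) // mulr_ge0 // ge0.
- move=> x z s s0 s1; have := leg_conv Lf x z s0 s1; have := leg_conv Lh x z s0 s1.
  move: (f _) (h _) (f x) (h x) (f z) (h z) => *; nra.
- by apply: (C1_spacetime_on (C1_comb a (1 - a) (leg_C1 Lf) (leg_C1 Lh))); exact: zero_time.
- move=> x z xz H; apply: (leg_strict Lf xz) => s s0 s1; have := H s s0 s1.
  have := leg_conv Lf x z s0 s1; have := leg_conv Lh x z s0 s1.
  move: (f _) (h _) (f x) (h x) (f z) (h z) => A B C D' E F h1 h2 h3.
  apply/eqP; rewrite eq_le h2 /=; nra.
- move=> x x0 [c [b [c0 bp H]]].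
  (* This [r] makes the combined intercept [I] larger than [b]; the lower bound [c t - b] at [t = r]
     then forces the combined slope [m] above [c]. *)
  have [r r0 Hr] := intercept_unbounded (b / a) Lf x0.
  have z0 : r *: x != 0 by rewrite scaler_eq0 negb_or gt_eqF.
  set z := r *: x in Hr z0.
  pose I := a * intercept f z + (1 - a) * intercept h z.
  pose m := a * dot x (grad f z) + (1 - a) * dot x (grad h z).
  have Ib : b < I.
    rewrite /I ltr_wpDr ?mulr_ge0 // 1?ltW ?intercept_gt0 //.
    by rewrite -ltr_pdivrMl // mulrC.
  have Hm s : s * m - I <= a * f (s *: x) + (1 - a) * h (s *: x).
    have h1 := legendre_grad (s *: x) Lf z0; have h2 := legendre_grad (s *: x) Lh z0.
    move: h1 h2; rewrite !dotZl /m /I.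
    move: (f _) (h _) (intercept _ _) (intercept _ _) (dot _ _) (dot _ _) => *; nra.
  have Ez : a * f z + (1 - a) * h z = r * m - I.
    by rewrite /m /I /intercept /z !dotZl; ring.
  have [h1 _] := H r (ltW r0); rewrite -/z Ez in h1.
  have cm : c < m by rewrite -(ltr_pM2l r0) [r * c]mulrC; lra.
  (* Here the tangent line [s m - I] equals [c s + 1], above the assumed upper bound. *)
  pose s := (I + 1) / (m - c).
  have mc : 0 < m - c by rewrite subr_gt0.
  have s0 : 0 < s by rewrite divr_gt0 //; lra.
  have [_ h2] := H s (ltW s0); have h3 := Hm s.
  have h4 : s * (m - c) = I + 1 by rewrite divfK // gt_eqF.
  move: h2 h3 h4; move: (_ + _) => A; nra.
Qed.

End Combination.

Section Congruence.
Variables (R : realType) (n : nat) (T : \bar R).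
Local Notation V := 'rV[R]_n.
Implicit Types F G : R -> V -> R.

(** Since [t < T], small increments stay below [T]; families that agree only on the time domain have
    the same [dt] there. *)
Lemma dt_eq F G x : (forall s, time_domain T s -> F s x = G s x) ->
  forall t, time_domain T t -> dt F t x = dt G t x.
Proof.
move=> FG t Dt; have [t0 tT] := Dt.
have E : \forall h \near time_incr t, dt_quotient F t x h = dt_quotient G t x h.
  have h1 := time_incr_ge0 t.
  have c : t + h @[h --> time_incr t] --> t.
    rewrite -[X in _ --> X]addr0; apply: cvgD; [exact: cvg_cst|exact: time_incr_cvg].
  have h2 : \forall h \near time_incr t, ((t + h)%:E < T)%E := c _ (lt_lifetime_near tT).
  by apply: filterS2 h1 h2 => h a b; rewrite /dt_quotient !FG.
rewrite /dt; congr (lim _); apply/seteqP; split => A; rewrite /= /fmap /= => hA.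
  by apply: filterS2 E hA => h /= ->.
by apply: filterS2 E hA => h /= ->.
Qed.

Lemma dt_eqfun F G : (forall s, time_domain T s -> F s = G s) ->
  forall t, time_domain T t -> dt F t = dt G t.
Proof. by move=> FG t Dt; apply/funext => x; apply: dt_eq => // s Ds; rewrite FG. Qed.

Lemma C2_eq F G : (forall s, time_domain T s -> F s = G s) ->
  C2_spacetime T F -> C2_spacetime T G.
Proof.
move=> FG [C1 Cdt CD]; split.
- by apply: C1_eq C1 => -[s x] [Ds _] /=; rewrite FG.
- by apply: C1_eq Cdt => -[s x] [Ds _] /=; rewrite (dt_eqfun FG).
- by move=> i; apply: C1_eq (CD i) => -[s x] [Ds _] /=; rewrite FG.
Qed.

Lemma C2_affine (f k : V -> R) : C2_on (@punctured R n) f -> C2_on (@punctured R n) k ->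
  C2_spacetime T (fun t x => f x + t * k x) /\
  forall t x, spacetime T (t, x) -> dt (fun t x => f x + t * k x) t x = k x.
Proof.
move=> [Cf CDf] [Ck CDk].
have C (a b : V -> R) : C1_on (@punctured R n) a -> C1_on (@punctured R n) b ->
    C1_spacetime T (fun t x => a x + t * b x).
  move=> Ca Cb; apply: C1D; first exact: C1_on_spacetime.
  by apply: C1M; [exact: C1_time|exact: C1_on_spacetime].
have cd (a b : V -> R) p (Ca : C1_on (@punctured R n) a) (Cb : C1_on (@punctured R n) b) (Dp : spacetime T p) :=
  cdiffD (C1_cdiff (C1_on_spacetime T Ca) Dp)
    (cdiffM (cdiff_time T p) (C1_cdiff (C1_on_spacetime T Cb) Dp)).
have E t x : spacetime T (t, x) -> dt (fun t x => f x + t * k x) t x = k x.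
  move=> Dp; have [[t0 _] _] := Dp.
  by rewrite (cdiff_dt Dp (cd _ _ _ Cf Ck Dp)).2 /= !dt_const // mulr0 add0r addr0 mul1r.
split => //; split; first exact: C.
- apply: (@C1_eq _ _ _ (fun _ => k)); last exact: C1_on_spacetime.
  by move=> [t x] Dp /=; rewrite E.
- move=> i; apply: (@C1_eq _ _ _ (fun t x => 'D_(std_basis R i) f x + t * 'D_(std_basis R i) k x)); last exact: C.
  move=> [t x] Dp /=.
  by rewrite (cdiff_D i Dp (cd _ _ _ Cf Ck Dp)).2 /= mul0r add0r.
Qed.

End Congruence.

(** * The linear flow: existence and uniqueness for the Cauchy problem *)

Section Flow.
Variables (R : realType) (n : nat) (u0 : 'rV[R]_n -> \bar R) (du0 : 'rV[R]_n -> R).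
Hypotheses (hu0 : S2 u0) (hu0_nl : nonlinear_at_infinity u0)
  (hdu0_0 : du0 0 = 0) (hT : (0 < lifespan u0 du0)%E).
Local Notation V := 'rV[R]_n.
Implicit Types (t : R) (x y z : V).

Let T := lifespan u0 du0.
Let U0 := fine \o u0.
(** The initial datum as a constant family for all times, so that the results on polars of families
    apply to [u0] itself. *)
Let f0 : R -> V -> R := fun=> U0.
Let psi := polar_fun f0 0.
Let X0 := polar_point f0 0.

Lemma u0E : u0 = EFin \o U0.
Proof. by have [h _ _] := hu0; have [/(_ (conj h hu0_nl)) []] := legendreP u0. Qed.

Let L0 t : time_domain (+oo%E : \bar R) t -> legendre (f0 t).
Proof. by have [h _ _] := hu0; have [/(_ (conj h hu0_nl)) []] := legendreP u0. Qed.

Let C0 : C2_spacetime +oo f0.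
Proof. by apply: C2_on_spacetime; case: hu0. Qed.

Let H0 t x : time_domain (+oo%E : \bar R) t -> x != 0 -> pos_def (hessian (f0 t) x).
Proof. by move=> _ x0; case: hu0 => _ _; exact. Qed.

Let zt : time_domain (+oo%E : \bar R) (0 : R) := zero_time R.

Lemma polar_u0 : polar u0 = EFin \o psi.
Proof. by rewrite {1}u0E; apply/funext => y; exact: (polar_funP C0 L0 y zt). Qed.

Lemma polar_psi : polar (EFin \o psi) = u0.
Proof. by rewrite u0E; exact: (polar_polar C0 L0 zt). Qed.

Let psi_C2 : C2_on (@punctured R n) psi.
Proof. exact: C2_spacetime_on (C2_polar C0 L0 H0) zt. Qed.

Let psi_leg : legendre psi.
Proof. exact: (legendre_polar C0 L0 H0 zt). Qed.

Let psi_pos y : y != 0 -> pos_def (hessian psi y).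
Proof. exact: (polar_pos_def C0 L0 H0 zt). Qed.

(** Because [u0] is its own bipolar, the polar subgradients of [polar u0] at [y] are the points of
    equality in [polar_young], that is, the maximizers for [y]. *)
Lemma polar_grad_u0 y : y != 0 -> polar_grad (polar u0) y = X0 y.
Proof.
move=> y0; suff E : polar_subdiff (polar u0) y = [set X0 y].
  rewrite /polar_grad; case: xgetP => [z _ /= Ez|/(_ (X0 y)) //].
  by have : [set X0 y] z by rewrite -E Ez.
have polpol : polar (polar u0) = EFin \o U0 by rewrite polar_u0 polar_psi {1}u0E.
apply/seteqP; split => [x [_ _]|_ ->].
  rewrite polpol polar_u0 /= -EFinM => -[E].
  have x0 : x != 0.
    apply: contra_eq_neq E => ->; rewrite (leg0 (L0 zt) : U0 0 = 0) mul0r dot0r sub0r eq_sym.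
    by rewrite oppr_eq0 oner_neq0.
  apply/esym/(polar_point_unique C0 L0 zt); split => //.
    rewrite dotC -E mulr_gt0 //; first exact: (leg_gt0 (L0 zt)).
    exact: (leg_gt0 psi_leg).
  move=> z; rewrite [dot x y]dotC -E mulrC -mulrA.
  apply: ler_wpM2l; first exact/ltW/(leg_gt0 (L0 zt)).
  by rewrite mulrC; exact: (polar_young C0 L0 _ _ zt).
split; rewrite /effective_dom /= ?polpol ?polar_u0 /= ?ltry //.
rewrite -EFinM dotC -(polar_eq C0 L0 zt y0); congr (_%:E); exact: mulrC.
Qed.

Let v := polar_velocity u0 du0.
Let kappa y : R := - (psi y * v y).

Lemma polar_flowE t : polar_flow u0 du0 t = EFin \o (fun y => psi y + t * kappa y).
Proof.
apply/funext => y; rewrite /polar_flow polar_u0 /= -EFinM; congr (_%:E).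
by rewrite /kappa -/v; ring.
Qed.

Let F t y := psi y + t * kappa y.

(** A time below the supremum is not itself known to be admissible; it lies strictly below one that
    is, and convex combinations descend from there. *)
Lemma admissible_time t : time_domain T t -> exists s, [/\ t < s, legendre (F s),
  C2_on (@punctured R n) (F s) & forall y, y != 0 -> pos_def (hessian (F s) y)].
Proof.
move=> [t0 tT]; have : (t%:E < ereal_sup [set (s%:E : \bar R) | s in
    [set s : R | [/\ (0 < s)%R, S2 (polar_flow u0 du0 s)
                   & nonlinear_at_infinity (polar_flow u0 du0 s)]]])%E.
  (* As [t >= 0], the alternative value 0 in the maximum cannot exceed [t]. *)
  by move: tT; rewrite /T /lifespan lt_max => /orP[|//]; rewrite lte_fin ltNge t0.
move=> /ereal_sup_gt [_ [s [s0 hS2 hnl] <-]]; rewrite lte_fin => ts.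
exists s; have [h1 h2 h3] := hS2.
have [_] := (legendreP _).1 (conj h1 hnl).
by move: h2 h3; rewrite polar_flowE => h2 h3 h4; split.
Qed.

Let T0 : time_domain T 0. Proof. by split. Qed.

(** The defining formula goes through [X0], which is known only to be C^1. The difference quotient
    of the flow between the times 0 and [s] shows instead that [kappa] inherits C^2 from [psi] and
    [F s]. *)
Lemma kappa_C2 : C2_on (@punctured R n) kappa.
Proof.
have [s [s0 _ Cs _]] := admissible_time T0.
have -> : kappa = fun y => s^-1 * F s y + (- s^-1) * psi y.
  by apply/funext => y; rewrite /F; field; rewrite gt_eqF.
exact: C2_comb.
Qed.

Lemma flow_C2 : C2_spacetime T F.
Proof. exact: (C2_affine T psi_C2 kappa_C2).1. Qed.

Lemma dt_flow t y : spacetime T (t, y) -> dt F t y = kappa y.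
Proof. exact: (C2_affine T psi_C2 kappa_C2).2. Qed.

Lemma dt_dt_flow t y : spacetime T (t, y) -> dt (dt F) t y = 0.
Proof.
move=> Dp; have [[t0 _] y0] := Dp; rewrite -(dt_const kappa y t0).
apply: (@dt_eq _ _ T) Dp.1 => s Ds; exact: dt_flow.
Qed.

(** For [0 <= t < s] this is a convex combination in which [psi] has positive weight, so properties
    stable under such combinations pass to [F t]. *)
Lemma flow_comb t s : 0 < s -> F t = fun y => (1 - t / s) * psi y + (1 - (1 - t / s)) * F s y.
Proof. by move=> s0; apply/funext => y; rewrite /F; field; rewrite gt_eqF. Qed.

Lemma flow_legendre t : time_domain T t -> legendre (F t).
Proof.
move=> Dt; have [s [ts Ls _ _]] := admissible_time Dt; have [t0 _] := Dt.
have s0 : 0 < s by apply: le_lt_trans ts.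
rewrite (flow_comb t s0); apply: legendre_comb => //.
  by rewrite subr_gt0 ltr_pdivrMr // mul1r.
by rewrite gerBl divr_ge0 // ltW.
Qed.

Lemma flow_pos_def t y : time_domain T t -> y != 0 -> pos_def (hessian (F t) y).
Proof.
move=> Dt y0; have [s [ts _ Cs Ps]] := admissible_time Dt; have [t0 _] := Dt.
have s0 : 0 < s by apply: le_lt_trans ts.
rewrite (flow_comb t s0) hessian_comb //; apply: pos_def_comb => //.
- by rewrite subr_gt0 ltr_pdivrMr // mul1r.
- by rewrite opprB addrC subrK divr_ge0 // ltW.
- exact: psi_pos.
- exact: Ps.
Qed.

Let C2F := flow_C2.
Let LF := flow_legendre.
Let HF := flow_pos_def.
Let G := polar_fun F.

Lemma polar_polar_flow t : time_domain T t -> polar (polar_flow u0 du0 t) = EFin \o G t.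
Proof. by move=> Dt; rewrite polar_flowE; apply/funext => x; exact: (polar_funP C2F LF x Dt). Qed.

(** Lets [polar_flow_equation] be applied to [G], whose polar is then the affine [F]. *)
Lemma polar_fun_dual t : time_domain T t -> polar_fun G t = F t.
Proof.
move=> Dt; apply/funext => y.
have := polar_polar C2F LF Dt; rewrite -/G => /(congr1 (fun k => k y)) /=.
by rewrite (@polar_funP _ _ T G (C2_polar C2F LF HF) (legendre_polar C2F LF HF) t y Dt) => -[].
Qed.

Lemma polar_flow0 : polar (polar_flow u0 du0 0) = u0.
Proof.
rewrite polar_flowE -polar_psi; congr (polar (_ \o _)).
by apply/funext => y; rewrite mul0r addr0.
Qed.

Lemma velocityE y : y != 0 -> v y = du0 (X0 y) / U0 (X0 y).
Proof. by move=> y0; rewrite /v /polar_velocity (negbTE y0) polar_grad_u0. Qed.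

Lemma flow_solution : nonlinear_solution u0 du0 T (fun t => polar (polar_flow u0 du0 t)).
Proof.
set U := fun (t : R) (x : V) => fine (polar (polar_flow u0 du0 t) x).
have UG t : time_domain T t -> U t = G t.
  by move=> Dt; apply/funext => x; rewrite /U polar_polar_flow.
have CG : C2_spacetime T G by exact: C2_polar.
have LG : forall t, time_domain T t -> legendre (G t) := legendre_polar C2F LF HF.
have HG : forall t x, time_domain T t -> x != 0 -> pos_def (hessian (G t) x) :=
  polar_pos_def C2F LF HF.
split.
- change (C2_spacetime T U); by apply: C2_eq CG => s Ds; rewrite UG.
- move=> t Dt; rewrite (polar_polar_flow Dt).
  have [h1 h2] := (legendreP (EFin \o G t)).2 (conj erefl (LG t Dt)).
  split; last exact: h2.
  split; [exact: h1|exact: C2_spacetime_on CG Dt|by move=> x x0; exact: HG].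
- move=> t x Dt x0.
  change (dt (dt (fun s z => (U s z)^-1)) t x +
    quad_form (invmx (hessian (U t) x)) (grad (fun z => dt U t z / U t z) x) = 0).
  rewrite (UG t Dt).
  rewrite (dt_eqfun (F := U) (G := G) UG Dt).
  have UGi : forall s, time_domain T s ->
      dt (fun s z => (U s z)^-1) s = dt (fun s z => (G s z)^-1) s.
    by apply: dt_eqfun => s Ds; rewrite UG.
  rewrite (dt_eqfun UGi Dt).
  (* The equation at [x] is read off at the dual point [y], where [x] appears as the maximizer of a
     polar affine in time; the factor in front of the bracket is positive. *)
  have [mx Xy] := polar_max_polar CG LG Dt x0; set y := _ *: _ in mx Xy.
  have y0 : y != 0 by case: mx.
  have Dp : spacetime T (t, y) by [].
  have := polar_flow_equation CG LG HG Dp.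
  rewrite Xy (dt_eqfun (dt_eqfun polar_fun_dual) Dt) dt_dt_flow // => /esym /eqP.
  rewrite mulf_eq0 => /orP[|/eqP //].
  rewrite mulf_eq0 (gt_eqF (leg_gt0 (LG t Dt) x0)) orbF polar_fun_dual //.
  by rewrite (gt_eqF (leg_gt0 (LF Dt) y0)).
- exact: polar_flow0.
- move=> x; change (dt U 0 x = du0 x); rewrite (dt_eqfun UG T0).
  (* At the origin every [G s] vanishes, in agreement with [du0 0 = 0]. *)
  have [->|x0] := eqVneq x 0.
    have E : dt G 0 0 = dt (fun _ (_ : V) => 0 : R) 0 0.
      by apply: (@dt_eq _ _ T) T0 => s _; exact: polar_fun0.
    by rewrite E hdu0_0 dt_const.
  have Dp : spacetime T (0, x) by [].
  (* The envelope formula, now with [F] as the family and [G] as its polar: the initial velocity at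
     [x] is [G 0 x] times [v] at the dual point [y], whose maximizer [X0 y] is [x]. *)
  rewrite (dt_polar C2F LF HF Dp) -/G.
  have [mx Xy] := polar_max_polar C0 L0 zt x0; set y := _ *: _ in mx Xy.
  have [y0 _ _] := mx.
  have F0 : F 0 = psi by apply/funext => z; rewrite /F mul0r addr0.
  have -> : polar_point F 0 x = y by apply: (polar_point_unique C2F LF T0); rewrite F0.
  have G0 : G 0 x = U0 x.
    have := polar_polar_flow T0; rewrite polar_flow0 {1}u0E.
    by move=> /(congr1 (fun k => k x)) /= [].
  have Dy : spacetime T (0, y) by [].
  rewrite G0 (dt_flow Dy) F0 /kappa (velocityE y0) /X0 Xy.
  have p0 : psi y != 0 by rewrite gt_eqF // (leg_gt0 psi_leg y0).
  have q0 : U0 x != 0 by rewrite gt_eqF // (leg_gt0 (L0 zt) x0).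
  by field; rewrite p0 q0.
Qed.

Lemma solution_unique (w : R -> V -> \bar R) : nonlinear_solution u0 du0 T w ->
  forall t, time_domain T t -> w t = polar (polar_flow u0 du0 t).
Proof.
move=> [CW Sw PDE w0 dw0].
set W := fun (t : R) (x : V) => fine (w t x) in CW PDE dw0.
have wE t : time_domain T t -> w t = EFin \o W t /\ legendre (W t).
  by move=> Dt; have [[h1 h2 h3] h4] := Sw t Dt; have [/(_ (conj h1 h4))] := legendreP (w t).
have LW t : time_domain T t -> legendre (W t) by move=> /wE [].
have HW t x : time_domain T t -> x != 0 -> pos_def (hessian (W t) x).
  by move=> Dt x0; have [[_ _ h] _] := Sw t Dt; exact: h.
pose g := polar_fun W.
have W0 : W 0 = U0 by rewrite /W w0.
have Cg : C2_spacetime T g := C2_polar CW LW HW.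
have [C1g C1dg _] := Cg.
have ddg t y : spacetime T (t, y) -> dt (dt g) t y = 0.
  move=> Dp; have [Dt y0] := Dp.
  rewrite (polar_flow_equation CW LW HW Dp) PDE ?mulr0 //.
  exact: (polar_point_neq0 CW LW Dt y0).
have gF t : time_domain T t -> g t = F t.
  move=> Dt; apply/funext => y; have [->|y0] := eqVneq y 0.
    by rewrite /g polar_fun0 /F /kappa /psi polar_fun0 mul0r oppr0 mulr0 addr0.
  have Dp s : time_domain T s -> spacetime T (s, y) by [].
  have X0E : polar_point W 0 y = X0 y.
    by apply: (polar_point_unique CW LW T0); rewrite W0; exact: (polar_pointP C0 L0 zt y0).
  have g0 : g 0 y = psi y.
    by rewrite /g /psi /polar_fun X0E W0.
  have dg0 : dt g 0 y = kappa y.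
    rewrite (dt_polar CW LW HW (Dp 0 T0)) -/g g0 X0E W0 dw0 /kappa velocityE //.
  have [t0 tT] := Dt.
  move: t0; rewrite le_eqVlt => /predU1P[<-|t0]; first by rewrite g0 /F mul0r addr0.
  have mid s : 0 <= s -> s <= t -> time_domain T s.
    by move=> s0 st; split => //; apply: le_lt_trans tT; rewrite lee_fin.
  have [s /andP[s0 st] E] := time_mvt C1g (Dp 0 T0) (Dp t Dt) t0.
  (* A second mean value, applied to [dt g], uses the vanishing second derivative to carry the
     initial velocity to time [s]. *)
  have dgs : dt g s y = kappa y.
    move: s0; rewrite le_eqVlt => /predU1P[<-//|s0].
    have [r /andP[r0 rs] E'] := time_mvt C1dg (Dp 0 T0) (Dp s (mid s (ltW s0) st)) s0.
    move: E'; rewrite ddg ?mulr0; first by rewrite dg0 => /eqP; rewrite subr_eq0 => /eqP.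
    by apply: Dp; apply: mid => //; exact: le_trans st.
  by move: E; rewrite dgs g0 subr0 /F => /eqP; rewrite subr_eq addrC => /eqP.
move=> t Dt; have [-> _] := wE t Dt.
(* The solution is recovered from its polar by biduality. *)
rewrite -(polar_polar CW LW Dt) -/g gF // polar_flowE //.
Qed.

End Flow.

Theorem theorem7p2 (R : realType) (n : nat)
    (u0 : 'rV[R]_n -> \bar R) (du0 : 'rV[R]_n -> R)
    (hu0 : S2 u0) (hu0_nl : nonlinear_at_infinity u0)
    (hdu0 : C2_on [set: 'rV[R]_n] du0) (hdu0_0 : du0 0 = 0)
    (hT : (0 < lifespan u0 du0)%E) :
  nonlinear_solution u0 du0 (lifespan u0 du0)
    (fun t => polar (polar_flow u0 du0 t)) /\
  (forall w : R -> 'rV[R]_n -> \bar R,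
     nonlinear_solution u0 du0 (lifespan u0 du0) w ->
     forall t, time_domain (lifespan u0 du0) t ->
       w t = polar (polar_flow u0 du0 t)).
Proof.
split; first exact: flow_solution.
by move=> w; exact: solution_unique.
Qed.
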